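(* (1) For every loop-free matroid $\mathcal M$ on $\{1,\dots,m\}$, the map $\Phi_{\mathcal M}:\mathbb R^m\to\operatorname{Berg}(\mathcal M)$ is a tropical toric vector bundle on the permutahedral variety $X_m$ with matroid $\mathcal M$; it is denoted $\mathfrak E_{\mathcal M}$ (the tautological tropical toric vector bundle of $\mathcal M$). (2) Let $L\subset \Bbbk^m$ be a linear subspace. If $\mathcal M(L)$ is loop-free, then $\mathfrak E_{\mathcal M(L)}$ is the tropicalization of the dual universal subbundle $\mathcal S_L^\vee$ (with respect to the $m$ coordinate functionals restricted to $L$, as a spanning set of the fiber $L^\vee$). If $\mathcal M^\vee(L)$ is loop-free, then $\phi_\chi^*\mathfrak E_{\mathcal M^\vee(L)}$ is the tropicalization of the universal quotient bundle $\mathcal Q_L$ (with respect to the images of the standard basis vectors in the fiber $\Bbbk^m/L$). (3) Let $\mathcal M$ be a matroid on $\{1,\dots,m\}$ with dual matroid $\mathcal M^\vee$. If $\mathcal M$ is loop-free, then $c_i^T(\mathfrak E_{\mathcal M})=c_i^T(\mathcal S_{\mathcal M}^\vee)$ for all $i$; if $\mathcal M^\vee$ is loop-free, then $c_i^T(\phi_\chi^*\mathfrak E_{\mathcal M^\vee})=c_i^T(\mathcal Q_{\mathcal M})$ for all $i$. Here the right-hand sides are the equivariant tautological Chern classes of the matroid $\mathcal M$ of Berget, Eur, Spink and Tseng.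
   Context: Bergman fan and apartments. For a loop-free matroid $\mathcal M$ of rank $r$ on $\{1,\dots,m\}$, $\operatorname{Berg}(\mathcal M)\subset\mathbb R^m$ is the set of $w$ such that for every circuit $C$ the minimum $\min_{i\in C}w_i$ is attained at least twice (equivalently, all sets $\{i: w_i\ge t\}$ are flats). For a basis $B$, the apartment $A_B$ is the set of $w\in\operatorname{Berg}(\mathcal M)$ for which $\sum_{b\in B}w_b$ is maximal among all bases. Projection to the $B$-coordinates is a bijection $A_B\to\mathbb R^B\cong\mathbb R^r$, with inverse $\phi_B$ given by $\phi_B(a)_b=a_b$ for $b\in B$ and $\phi_B(a)_e=\min\{a_b: b\in C_e\setminus\{e\}\}$ for $e\notin B$, where $C_e$ is the unique circuit in $B\cup\{e\}$. Permutahedral variety. $\Sigma_m$ is the complete fan in $\mathbb R^m$ (with lineality space spanned by $(1,\dots,1)$) whose maximal cones are $C_\pi=\{w: w_{\pi(1)}\ge\dots\ge w_{\pi(m)}\}$, $\pi\in S_m$. $X_m$ is the toric variety of the image of this fan in $\mathbb R^m/\mathbb R(1,\dots,1)$; the torus $T=\mathbb G_m^m$ acts on $X_m$ through its quotient by the diagonal $\mathbb G_m$, and $x_0$ is the identity point of the open orbit. A tropical toric vector bundle on $X_m$ with matroid $\mathcal M$ is a map $\Phi:\mathbb R^m\to\operatorname{Berg}(\mathcal M)$ with $\Phi(\mathbb Z^m)\subset\mathbb Z^m$ such that for every cone $\sigma\in\Sigma_m$ there is a basis $B_\sigma$ with $\Phi(\sigma)\subset A_{B_\sigma}$ and such that $\Phi|_\sigma$,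 in the coordinates $A_{B_\sigma}\cong\mathbb R^{B_\sigma}$, is the restriction of a linear map. The map $\Phi_{\mathcal M}$: for $w\in\mathbb R^m$, $\Phi_{\mathcal M}(w)_i=\sup\{k\in\mathbb R: i\in\operatorname{span}\{j: w_j\ge k\}\}$, where span denotes matroid closure. Cremona map. $\chi:\mathbb R^m\to\mathbb R^m$, $\chi(x)=-x$, corresponds to $t\mapsto t^{-1}$ on $T$ and permutes the cones of $\Sigma_m$; $\phi_\chi:X_m\to X_m$ is the induced morphism. The pullback $\phi_\chi^*\mathfrak E$ of the tropical toric vector bundle given by $\Phi$ is the one given by $\Phi\circ\chi$. Equivariant Chern classes. $c_i^T(\mathfrak E)$ is the piecewise polynomial function on $\mathbb R^m$ given by $\epsilon_{\mathcal M,i}\circ\Phi$, where $\epsilon_{\mathcal M,i}:\operatorname{Berg}(\mathcal M)\to\mathbb R$ is the function which on each apartment $A_B\cong\mathbb R^B$ equals the $i$-th elementary symmetric function of the coordinates. Bundles from $L$. Let $\delta_1,\dots,\delta_m$ be the standard basis of the character lattice $\mathbb Z^m$ of $T$. For $u\in\mathbb Z^m$, $\mathcal O_u$ is the trivial line bundle with $T$ acting on the fiber through the character $u$. $\mathcal S_L^\circ\subset\bigoplus_i\mathcal O_{\delta_i}$ is the unique $T$-equivariant subbundle on $X_m$ with fiber $L\subset\Bbbk^m$ at $x_0$, and $\mathcal Q_L^\circ$ is the quotient. $\mathcal S_L=\phi_\chi^*\mathcal S_L^\circ$ and $\mathcal Q_L=\phi_\chi^*\mathcal Q_L^\circ$,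 so $0\to\mathcal S_L\to\bigoplus_i\mathcal O_{-\delta_i}\to\mathcal Q_L\to0$ is exact, and dually $\mathcal S_L^\vee$ is a quotient of $\bigoplus_i\mathcal O_{\delta_i}$. $\mathcal M^\vee(L)$ is the matroid on $\{1,\dots,m\}$ whose circuits are the minimal supports of nonzero vectors of $L$ (the matroid of the images of the standard basis in $\Bbbk^m/L$), and $\mathcal M(L)$ is its dual (the matroid of the coordinate functionals restricted to $L$). Tropicalization. Let $\mathcal E$ be a $T$-equivariant vector bundle on $X_m$ with fiber $E=\mathcal E_{x_0}$ and let $f_1,\dots,f_m\in E$ be nonzero vectors spanning $E$. For $x\in\mathbb Z^m$ let $\lambda_x(s)=(s^{x_1},\dots,s^{x_m})$ and, for $0\ne f\in E$, $\operatorname{val}_x(f)=\max\{k\in\mathbb Z:\lim_{s\to0}s^{-k}\lambda_x(s)\cdot f\text{ exists in }\mathcal E\}$. To say that the tropicalization of $\mathcal E$ with respect to $f_1,\dots,f_m$ is the tropical toric vector bundle with map $\Phi$ and matroid $\mathcal M$ means that $\mathcal M$ is the linear matroid of $(f_1,\dots,f_m)$, that $\Phi(x)=(\operatorname{val}_x(f_1),\dots,\operatorname{val}_x(f_m))$ for all $x\in\mathbb Z^m$, and that $\mathcal E$ is the toric vector bundle determined by this data (i.e. for all $x\in\mathbb Z^m$ and $k$, $\{f:\operatorname{val}_x(f)\ge k\}\cup\{0\}=\operatorname{span}\{f_i:\Phi(x)_i\ge k\}$). Tautological Chern classes of a matroid. For $\pi\in S_m$ let $B_\pi(\mathcal M)$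 be the lexicographically first basis of $\mathcal M$ with respect to the order $\pi(1)<\dots<\pi(m)$. $c_i^T(\mathcal S_{\mathcal M}^\vee)$ (resp. $c_i^T(\mathcal Q_{\mathcal M})$) is the piecewise polynomial function on $\Sigma_m$ whose restriction to $C_\pi$ is the $i$-th elementary symmetric polynomial in $\{x_j: j\in B_\pi(\mathcal M)\}$ (resp. in $\{-x_j: j\notin B_\pi(\mathcal M)\}$). *)

(* Defs.v *)
From HB Require Import structures.
From mathcomp Require Import all_classical all_reals.
(* Imported last so that [set0], [setT], [set x | P] ... are those of finset;
   their classical counterparts are written with %classic below. *)
From mathcomp Require Import all_boot all_order all_algebra all_fingroup.

Set Implicit Arguments.
Unset Strict Implicit.
Unset Printing Implicit Defensive.

Import Order.TTheory GRing.Theory Num.Theory.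
Local Open Scope ring_scope.

Record matroid (T : finType) := Matroid {
  bases : {set {set T}};
  bases_neq0 : bases != set0;
  bases_exchange : forall B1 B2 x, B1 \in bases -> B2 \in bases ->
    x \in B1 :\: B2 ->
    exists2 y, y \in B2 :\: B1 & y |: (B1 :\ x) \in bases }.

Section Matroid.
Variables (T : finType) (M : matroid T).
Implicit Types (A B C I : {set T}).

Definition indep I := [exists B in bases M, I \subset B].
Definition circuit C := ~~ indep C && [forall e in C, indep (C :\ e)].
Definition rank A := (\max_(I : {set T} | (I \subset A) && indep I) #|I|)%N.
Definition mspan A : {set T} := [set e | rank (e |: A) == rank A]%SET.
Definition loop_free := [forall e, indep [set e]%SET].

Definition basis0 := xchoose (set0Pn _ (bases_neq0 M)).

Lemma basis0P : basis0 \in bases M.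
Proof. exact: xchooseP. Qed.

Lemma card_basis B1 B2 : B1 \in bases M -> B2 \in bases M -> #|B1| = #|B2|.
Proof.
have [n] := ubnP #|B1 :\: B2|; elim: n B1 => // n IHn B1 ltn B1b B2b.
have [D0|/set0Pn[x xD]] := eqVneq (B1 :\: B2) set0.
  congr #|pred_of_set _|; apply/eqP.
  rewrite eqEsubset -setD_eq0 D0 eqxx /=; apply/subsetP => x xB2.
  apply/negPn/negP => xNB1.
  have [|y] := bases_exchange B2b B1b (x := x); first by rewrite inE xNB1.
  by rewrite D0 inE.
have [y yD B'b] := bases_exchange B1b B2b xD.
move: xD yD; rewrite !inE => /andP[xNB2 xB1] /andP[yNB1 yB2].
have -> : #|B1| = #|y |: (B1 :\ x)|.
  by rewrite cardsU1 !inE (negPf yNB1) andbF (cardsD1 x B1) xB1.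
apply: IHn => //; move: ltn; rewrite ltnS; apply: leq_trans; apply: proper_card.
apply/properP; split; last first.
  exists x; rewrite !inE xNB2 // eqxx /= orbF.
  by apply: contraNneq yNB1 => <-.
apply/subsetP => z; rewrite !inE => /andP[zNB2].
by case: eqVneq => [zy|_ /= /andP[_ ->]]; [rewrite zy yB2 in zNB2 | rewrite zNB2].
Qed.

Lemma dual_exchange B1 B2 x : B1 \in bases M -> B2 \in bases M ->
  x \in B2 :\: B1 ->
  exists2 y, y \in B1 :\: B2 & x |: (B1 :\ y) \in bases M.
Proof.
move=> B1b B2b; rewrite inE => /andP[xNB1 xB2].
pose P B := [&& B \in bases M, x \in B & B1 :&: B2 \subset B].
have P2 : P B2 by rewrite /P B2b xB2 subsetIr.
case: (arg_minnP (fun B => #|B :\: (x |: B1)|) P2) => B /and3P[Bb xB IB] minB.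
have sB : B \subset x |: B1.
  rewrite -setD_eq0; apply/negPn/negP => /set0Pn[z zD].
  move: (zD); rewrite !inE negb_or => /andP[/andP[zx zNB1] zB].
  have [|y] := bases_exchange Bb B1b (x := z); first by rewrite inE zNB1.
  rewrite inE => /andP[yNB yB1] B'b.
  have /minB : P (y |: (B :\ z)).
    rewrite /P B'b !inE xB (eq_sym x z) zx orbT /=; apply/subsetP => u uI.
    rewrite !inE (subsetP IB) // andbT; apply/orP; right.
    by apply: contraNneq zNB1 => <-; move: uI; rewrite inE => /andP[].
  rewrite leqNgt => /negP[]; apply: proper_card; apply/properP; split.
    apply/subsetP => u; rewrite !inE => /andP[uN]; rewrite uN /=.
    by case: eqVneq => [uy|_ /= /andP[]//]; rewrite uy yB1 orbT in uN.
  exists z => //; rewrite !inE eqxx /= orbF negb_and; apply/orP; right.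
  by apply: contraNneq zNB1 => ->.
have cB : #|B| = #|B1| by apply: card_basis.
have [y yD] : exists y, y \in B1 :\: B.
  apply/set0Pn; rewrite setD_eq0; apply/negP => sB1.
  have /eqP E : B1 == B by rewrite eqEcard sB1 cB leqnn.
  by rewrite E xB in xNB1.
move: yD; rewrite inE => /andP[yNB yB1]; exists y.
  rewrite inE yB1 andbT; apply: contra yNB => yB2.
  by apply: (subsetP IB); rewrite inE yB1.
suff -> : x |: (B1 :\ y) = B by [].
apply/esym/eqP; rewrite eqEcard cardsU1 !inE (negPf xNB1) andbF /= cB.
rewrite (cardsD1 y B1) yB1 leqnn andbT; apply/subsetP => u uB.
move: (subsetP sB _ uB); rewrite !inE => /orP[->//|->]; rewrite andbT.
by apply/orP; right; apply: contraNneq yNB => <-.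
Qed.

Fact dual_neq0 : [set ~: B | B in bases M]%SET != set0.
Proof. by apply/set0Pn; exists (~: basis0); apply: imset_f (basis0P). Qed.

Fact dual_exchangeC C1 C2 x :
  C1 \in [set ~: B | B in bases M]%SET -> C2 \in [set ~: B | B in bases M]%SET ->
  x \in C1 :\: C2 ->
  exists2 y, y \in C2 :\: C1 & y |: (C1 :\ x) \in [set ~: B | B in bases M]%SET.
Proof.
move=> /imsetP[B1 B1b ->] /imsetP[B2 B2b ->].
rewrite !inE negbK => /andP[xB2 xNB1].
have [|y] := dual_exchange B1b B2b (x := x); first by rewrite inE xNB1.
rewrite inE => /andP[yNB2 yB1] Bb; exists y; first by rewrite !inE negbK yB1.
apply/imsetP; exists (x |: (B1 :\ y)) => //; apply/setP => u.
rewrite !inE negb_or negb_and negbK.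
have yx : y != x by apply: contraNneq xNB1 => <-.
by case: (eqVneq u y) => //= ->; rewrite yx.
Qed.

Definition mdual := Matroid dual_neq0 dual_exchangeC.

End Matroid.

(* Linear independence of the subfamily is that of the family, not of the set
   of its values: repeated vectors are dependent. *)
Definition is_linear_matroid (k : fieldType) (E : vectType k) m
    (f : 'I_m -> E) (M : matroid 'I_m) :=
  forall I : {set 'I_m}, indep M I = free [seq f i | i <- enum I].

Definition supp (k : fieldType) m (v : 'rV[k]_m) : {set 'I_m} :=
  [set i | v 0 i != 0]%SET.

Definition is_minimal_support (k : fieldType) m (L : {vspace 'rV[k]_m})
    (C : {set 'I_m}) :=
  (exists v, [/\ v \in L, v != 0 & supp v = C]) /\
  (forall v, v \in L -> v != 0 -> supp v \subset C -> supp v = C).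

Section Bergman.
Variables (R : realType) (m : nat) (M : matroid 'I_m).
Implicit Types (w : 'rV[R]_m) (B C : {set 'I_m}).

Definition berg : set 'rV[R]_m := [set w | forall C, circuit M C ->
  exists i j, [/\ i \in C, j \in C, i != j, w 0 i = w 0 j &
                  forall l, l \in C -> w 0 i <= w 0 l]]%classic.

Definition apartment B : set 'rV[R]_m := [set w | berg w /\
  forall B', B' \in bases M -> \sum_(b in B') w 0 b <= \sum_(b in B) w 0 b]%classic.

Definition esym w B i : R :=
  \sum_(I : {set 'I_m} | (I \subset B) && (#|I| == i)) \prod_(b in I) w 0 b.

(* A point of [berg] lies in the apartments of its bases of maximal weight; by
   [esym_bergE] below the choice of such a basis is immaterial. *)
Definition max_basis w : {set 'I_m} :=
  [arg max_(B > basis0 M in bases M) \sum_(b in B) w 0 b]%O.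

Definition esym_berg i w : R := esym w (max_basis w) i.

Lemma max_basisP w : max_basis w \in bases M /\
  forall B', B' \in bases M ->
    \sum_(b in B') w 0 b <= \sum_(b in max_basis w) w 0 b.
Proof.
rewrite /max_basis; case: arg_maxP => [|B Bb maxB]; first exact: basis0P.
by split=> // B'; apply: maxB.
Qed.

Lemma esym_swap w B x y i : x \in B -> y \notin B -> w 0 x = w 0 y ->
  esym w (y |: (B :\ x)) i = esym w B i.
Proof.
move=> xB yNB wxy; pose t := tperm x y.
have tw z : w 0 (t z) = w 0 z by rewrite /t; case: tpermP => [->|->|].
have tB : y |: (B :\ x) = t @: B.
  have xy : x != y by apply: contraNneq yNB => <-.
  apply/setP => z; have [u ->] : exists u, z = t u.
    by exists (t z); rewrite /t tpermK.
  rewrite mem_imset; last exact: perm_inj.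
  rewrite !inE /t; case: tpermP => [->|->|].
  - by rewrite eqxx xB.
  - by rewrite (negPf xy) eqxx (negPf yNB).
  by move=> /eqP ux /eqP uy; rewrite (negPf ux) (negPf uy).
rewrite /esym (reindex_inj (imset_inj (@perm_inj _ t))) /=.
apply: eq_big => [I|I _].
  rewrite card_imset; last exact: perm_inj.
  rewrite tB; congr (_ && _); apply/idP/idP; last exact: imsetS.
  move=> /subsetP sIB; apply/subsetP => z zI.
  by have := sIB _ (imset_f t zI); rewrite mem_imset //; apply: perm_inj.
rewrite big_imset /=; last by move=> ? ? _ _; apply: perm_inj.
by apply: eq_bigr => z _; rewrite tw.
Qed.

Let maxw w B := B \in bases M /\
  forall B', B' \in bases M -> \sum_(b in B') w 0 b <= \sum_(b in B) w 0 b.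

Let maxw_swap w B B' z : maxw w B -> B' \in bases M -> z \in B :\: B' ->
  (forall y, y \in B' :\: B -> w 0 z <= w 0 y) ->
  exists y, [/\ y \in B' :\: B, maxw w (y |: (B :\ z)) & w 0 z = w 0 y].
Proof.
move=> [Bb Bmax] B'b zD zmin; have [y yD B1b] := bases_exchange Bb B'b zD.
move: (zD) (yD); rewrite !inE => /andP[zNB' zB] /andP[yNB yB'].
have sumB : \sum_(b in B) w 0 b = w 0 z + \sum_(b in B :\ z) w 0 b.
  by rewrite (big_setD1 z).
have sumB1 : \sum_(b in y |: (B :\ z)) w 0 b = w 0 y + \sum_(b in B :\ z) w 0 b.
  by rewrite big_setU1 //= !inE (negPf yNB) andbF.
have wzy : w 0 z = w 0 y.
  apply/eqP; rewrite eq_le zmin //=.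
  by have := Bmax _ B1b; rewrite sumB sumB1 lerD2r.
by exists y; split=> //; split=> // B2 /Bmax; rewrite sumB sumB1 wzy.
Qed.

Let esym_maxw w B B' i : maxw w B -> maxw w B' -> esym w B i = esym w B' i.
Proof.
have [n] := ubnP #|B :\: B'|; elim: n B B' => // n IHn B B' ltn Bm B'm.
have [D0|/set0Pn[z0 z0D]] := eqVneq ((B :\: B') :|: (B' :\: B)) set0.
  congr esym; apply/eqP; rewrite eqEsubset -!setD_eq0.
  by rewrite -!subset0 -D0 subsetUl subsetUr.
pose P z := z \in (B :\: B') :|: (B' :\: B).
case: (@arg_minP _ _ _ z0 P (fun z => w 0 z) z0D) => z.
rewrite /P in_setU => /orP[] zD zmin.
  have [|y [yD B1m wzy]] := maxw_swap Bm B'm.1 zD.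
    by move=> y yD; apply: zmin; rewrite in_setU yD orbT.
  move: (zD) (yD); rewrite !inE => /andP[zNB' zB] /andP[yNB yB'].
  rewrite -(esym_swap i zB yNB wzy); apply: IHn => //.
  move: ltn; rewrite ltnS; apply: leq_trans; apply: proper_card.
  apply/properP; split; last first.
    exists z => //; rewrite !inE eqxx /= orbF.
    by rewrite negb_and; apply/orP; right; apply: contraNneq zNB' => ->.
  apply/subsetP => u; rewrite !inE => /andP[uNB'].
  case: eqVneq => [uy|_ /= /andP[_ ->]]; last by rewrite uNB'.
  by rewrite uy yB' in uNB'.
have [|y [yD B1m wzy]] := maxw_swap B'm Bm.1 zD.
  by move=> y yD; apply: zmin; rewrite in_setU yD.
move: (zD) (yD); rewrite !inE => /andP[zNB zB'] /andP[yNB' yB].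
rewrite -(esym_swap i zB' yNB' wzy); apply: IHn => //.
move: ltn; rewrite ltnS; apply: leq_trans; apply: proper_card.
apply/properP; split; last by exists y => //; rewrite !inE eqxx.
apply/subsetP => u; rewrite !inE !negb_or negb_and negbK => /andP[/andP[_ +] uB].
by rewrite uB andbT; case: eqVneq => // uz; rewrite -uz uB in zNB.
Qed.

Lemma esym_bergE w B i : B \in bases M -> apartment B w ->
  esym_berg i w = esym w B i.
Proof. by move=> Bb [_ Bmax]; apply: esym_maxw => //; apply: max_basisP. Qed.

End Bergman.

Definition pairing (K : pzRingType) m (u w : 'rV[K]_m) : K :=
  \sum_i u 0 i * w 0 i.

Definition cone (K : numDomainType) m (s : 'S_m) : set 'rV[K]_m :=
  [set w | forall i j : 'I_m, (i <= j)%N -> w 0 (s j) <= w 0 (s i)]%classic.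

(* The cones of the permutahedral fan are the faces of the [cone s], obtained
   by turning some of the inequalities between consecutive entries into
   equalities. *)
Definition in_fan (K : numDomainType) m (sigma : set 'rV[K]_m) :=
  exists (s : 'S_m) (J : {set 'I_m}), sigma = [set w | cone s w /\
    forall i j : 'I_m, i \in J -> j = i.+1 :> nat -> w 0 (s i) = w 0 (s j)]%classic.

Section Tropical.
Variables (R : realType) (m : nat) (M : matroid 'I_m).

Definition integral (w : 'rV[R]_m) := forall i, w 0 i \is a Num.int.

Definition tropical_bundle (Phi : 'rV[R]_m -> 'rV[R]_m) :=
  [/\ forall w, berg M (Phi w),
      forall w, integral w -> integral (Phi w) &
      forall sigma, in_fan sigma -> exists2 B, B \in bases M &
        (forall w, sigma w -> apartment M B (Phi w)) /\
        exists f : {linear 'rV[R]_m -> 'rV[R]_m},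
          forall w, sigma w -> forall b, b \in B -> Phi w 0 b = f w 0 b].

Definition tautological_map (w : 'rV[R]_m) : 'rV[R]_m :=
  \row_i sup [set k : R | i \in mspan M [set j | k <= w 0 j]%SET]%classic.

Definition tropical_chern (Phi : 'rV[R]_m -> 'rV[R]_m) i (w : 'rV[R]_m) : R :=
  esym_berg M i (Phi w).

(* The elements of [B] listed by their positions in [s 0 < s 1 < ...]. *)
Definition lex_key (s : 'S_m) (B : {set 'I_m}) : seqlexi nat :=
  [seq val p | p <- enum 'I_m & s p \in B].

Definition lex_basis (s : 'S_m) : {set 'I_m} :=
  [arg min_(B < basis0 M in bases M) lex_key s B]%O.

Definition is_chern_dual_sub i (c : 'rV[R]_m -> R) :=
  forall s w, cone s w -> c w = esym w (lex_basis s) i.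

Definition is_chern_quotient i (c : 'rV[R]_m -> R) :=
  forall s w, cone s w -> c w = esym (- w) (~: lex_basis s) i.

End Tropical.

Definition pull_cremona (R : realType) m (Phi : 'rV[R]_m -> 'rV[R]_m) w :=
  Phi (- w).

(* The permutahedral variety X is covered by the affine charts U_s attached to
   the maximal cones [cone s].  Let E be the fiber at x0 of an equivariant vector
   bundle.  The action identifies the pull-back of the bundle along the orbit map
   t |-> t . x0 with the trivial bundle E on T, so that a section h over U_s
   becomes the E-valued Laurent polynomial n(t) = t^-1 . h(t . x0), and the bundle
   is recorded by the k[U_s]-modules of the Laurent polynomials obtained this way.

   A Laurent polynomial \sum_a n_a t^a is given by its coefficient function
   a |-> n_a, which has finite support; exponents are in a group [G], which is
   Z^m for functions on T and Z for functions of the parameter z of a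
   one-parameter subgroup. *)

Section Laurent.
Variables (k : fieldType) (G : zmodType) (E : lmodType k).
Implicit Types (n : G -> E) (D : set G) (N : set (G -> E)).

Definition finsupp n := finite_set [set a | n a != 0]%classic.
Definition monomial (a : G) (f : E) : G -> E := fun b => if b == a then f else 0.
Definition shift (a : G) n : G -> E := fun b => n (b - a).

(* The submodule generated by [N] over the ring spanned by the t^d, d in [D]. *)
Inductive submod_gen D N : (G -> E) -> Prop :=
| submod_gen0 : submod_gen D N (fun=> 0)
| submod_genS c d n h : D d -> N n -> submod_gen D N h ->
    submod_gen D N (fun b => c *: shift d n b + h b).

End Laurent.

Definition sections (k : fieldType) m (E : lmodType k) :=
  'S_m -> set ('rV[int]_m -> E).

Section Bundles.
Variables (k : fieldType) (m : nat).
Local Notation expo := 'rV[int]_m.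
Implicit Types (s : 'S_m) (E Q : vectType k).

(* The characters of T that are regular on the affine toric variety of [sigma];
   as the cones contain (1, ..., 1) and its opposite, these are characters of the
   quotient of T by the diagonal. *)
Definition regular_char (sigma : set expo) : set expo :=
  [set u | forall w, sigma w -> 0 <= pairing u w]%classic.

Definition chart_char s := regular_char (cone s).
Definition overlap_char s s' := regular_char (cone s `&` cone s')%classic.

Definition eval1 E (n : expo -> E) : E := \sum_(a \in [set: expo]%classic) n a.

(* The Laurent polynomial n(lambda_x(z)) in z, where lambda_x(z)_i = z^(x_i). *)
Definition restrict_curve E (x : expo) (n : expo -> E) : int -> E :=
  fun b => \sum_(a \in [set a | pairing a x = b]%classic) n a.

(* The direct sum of the line bundles O_(u i).  A section has components h_i in
   k[U_s], and t^-1 . h(t . x0) has components t^(- u i) h_i. *)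
Definition split_bundle p (u : 'I_p -> expo) : sections m 'rV[k]_p :=
  fun s => [set n : expo -> 'rV[k]_p | finsupp n /\
    forall i a, n a 0 i != 0 -> chart_char s (a + u i)]%classic.

Definition standard_bundle : sections m 'rV[k]_m :=
  split_bundle (fun i : 'I_m => delta_mx 0 i).

(* In the conditions below: inclusion; being a k[U_s]-submodule; being a direct
   summand over U_s; agreement on overlaps of charts; stability under T, which
   acts on the sections by the translations n(t) |-> n(t0^-1 t), so that stable
   submodules are those that contain the monomials of their elements. *)
Definition is_equivariant_subbundle E (V S : sections m E) :=
  [/\ forall s n, S s n -> V s n,
      forall s n, submod_gen (chart_char s) (S s) n -> S s n,
      forall s, exists C : set (expo -> E),
        [/\ forall n, C n -> V s n,
            forall n, submod_gen (chart_char s) C n -> C n,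
            forall n, S s n -> C n -> n = (fun=> 0) &
            forall n, V s n -> exists n1 n2,
              [/\ S s n1, C n2 & n = (fun a => n1 a + n2 a)]],
      forall s s' n, S s n -> submod_gen (overlap_char s s') (S s') n &
      forall s n a, S s n -> S s (monomial a (n a))].

Definition has_fiber E (S : sections m E) (L : {vspace E}) :=
  forall s f, f \in L <-> exists2 n, S s n & eval1 n = f.

(* A subbundle with fiber [L] at x0, as a bundle with fiber [subvs_of L]. *)
Definition as_bundle E (L : {vspace E}) (S : sections m E) :
    sections m (subvs_of L) :=
  fun s => [set n | S s (fun a => vsval (n a))]%classic.

(* 0 -> S -> V -> W -> 0 is exact, where [q] is the surjection from the fiber of
   V at x0 onto that of W; over the affine charts, exactness is that of the
   sequences of modules of sections. *)
Definition exact_sequence E Q (S V : sections m E) (q : 'Hom(E, Q))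
    (W : sections m Q) :=
  forall s,
  [/\ forall n, V s n -> W s (fun a => q (n a)),
      forall n', W s n' -> exists2 n, V s n & n' = (fun a => q (n a)) &
      forall n, S s n <-> V s n /\ forall a, q (n a) = 0].

(* Hom(S(U_s), k[U_s]), as a module of Laurent polynomials with coefficients in
   the dual of the fiber. *)
Definition dual_bundle E (S : sections m E) : sections m 'Hom(E, k^o) :=
  fun s => [set phi | finsupp phi /\ forall n, S s n ->
    forall b, \sum_(a \in [set: expo]%classic) phi a (n (b - a)) != 0 ->
      chart_char s b]%classic.

(* The Cremona map sends [cone s] to [cone (cremona_perm s)]; the torus acts on
   the pull-back through t |-> t^-1, and n(t) is pulled back to n(t^-1). *)
Definition cremona_perm s : 'S_m := (perm (@rev_ord_inj m) * s)%g.

Definition pull_cremona_bundle E (F : sections m E) : sections m E :=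
  fun s => [set n | F (cremona_perm s) (fun a => n (- a))]%classic.

(* Existence of the limit of z^-d lambda_x(z) . f as z -> 0: the point
   lambda_x(z) . x0 tends to a point of U_s for [x] in [cone s], and the section
   z^-d lambda_x(z) . f of the restriction of the bundle to the punctured line has
   to extend to a section over the line, that is to a combination of
   restrictions of sections over U_s with coefficients in k[z].  In terms of
   [sections], lambda_x(z)^-1 has to be applied to all of these. *)
Definition limit_exists E (F : sections m E) (x : expo) (d : int) (f : E) :=
  exists2 s, cone s x &
    submod_gen [set a : int | 0 <= a]%classic
      [set restrict_curve x n | n in F s]%classic (monomial (- d) f).

Definition is_val E (F : sections m E) x f (d : int) :=
  limit_exists F x d f /\ forall d', limit_exists F x d' f -> d' <= d.

Definition int_row (R : realType) (x : expo) : 'rV[R]_m := map_mx intr x.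

Definition is_tropicalization (R : realType) E (F : sections m E)
    (f : 'I_m -> E) (M : matroid 'I_m) (Phi : 'rV[R]_m -> 'rV[R]_m) :=
  [/\ tropical_bundle M Phi,
      (forall i, f i != 0) /\ <<[seq f i | i <- enum 'I_m]>>%VS = fullv,
      is_linear_matroid f M,
      forall x i, exists2 d, is_val F x (f i) d & Phi (int_row R x) 0 i = d%:~R &
      forall x (d : int) g,
        (g = 0 \/ exists2 e, is_val F x g e & d <= e) <->
        g \in <<[seq f i | i <- enum 'I_m & (d%:~R <= Phi (int_row R x) 0 i)%R]>>%VS].

Definition coordinate (L : {vspace 'rV[k]_m}) (i : 'I_m) :
    'Hom(subvs_of L, k^o) := linfun (fun v : subvs_of L => vsval v 0 i : k^o).

End Bundles.

Arguments tautological_map R {m} M w.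
Arguments as_bundle {k m E} L S.
Arguments coordinate {k m} L i.
Arguments standard_bundle : clear implicits.

Section Existence.
Variables (k : fieldType) (m : nat) (L : {vspace 'rV[k]_m}).
Local Notation expo := 'rV[int]_m.
Local Notation delta i := (delta_mx 0 i : expo).
Implicit Types (s : 'S_m) (a b u : expo) (v : 'rV[k]_m) (K : {vspace 'rV[k]_m}).

Let pairingD u u' (w : expo) : pairing (u + u') w = pairing u w + pairing u' w.
Proof. by rewrite -big_split; apply: eq_bigr => i _; rewrite mxE mulrDl. Qed.

Let pairingN u (w : expo) : pairing (- u) w = - pairing u w.
Proof. by rewrite -sumrN; apply: eq_bigr => i _; rewrite mxE mulNr. Qed.

Let pairing_delta i (w : expo) : pairing (delta i) w = w 0 i.
Proof.
rewrite /pairing (bigD1 i) //= mxE !eqxx mul1r big1 ?addr0 // => j ji.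
by rewrite mxE eqxx (negPf ji) mul0r.
Qed.

Let chartD s u u' : chart_char s u -> chart_char s u' -> chart_char s (u + u').
Proof. by move=> uP u'P w /[dup] /uP + /u'P; rewrite pairingD; apply: addr_ge0. Qed.

Let part K : sections m 'rV[k]_m :=
  fun s => [set n | standard_bundle k m s n /\ forall a, n a \in K]%classic.

Let part_gen K s n : submod_gen (chart_char s) (part K s) n -> part K s n.
Proof.
elim=> [|c d {}n h dP [[nfin nP] nK] _ [[hfin hP] hK]].
  split=> [|a]; last exact: rpred0.
  split=> [|i a]; last by rewrite mxE; case/eqP.
  rewrite /finsupp.
  apply: (@sub_finite_set _ _ classical_sets.set0) => [a /= /eqP//|].
  exact: finite_set0.
split=> [|a]; last by apply: rpredD (hK a); apply/rpredZ/nK.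
split=> [|i a].
  apply: (@sub_finite_set _ _
    ([set b + d | b in [set b | n b != 0]] `|` [set b | h b != 0])%classic).
    move=> a /=; rewrite /shift; have [na|na] := eqVneq (n (a - d)) 0.
      by rewrite na scaler0 add0r; right.
    by move=> _; left; exists (a - d) => //; rewrite subrK.
  by rewrite finite_setU; split=> //; apply: finite_image.
rewrite !mxE /shift; have [nz|/nP nd] := eqVneq (n (a - d) 0 i) 0.
  by rewrite nz mulr0 add0r => /hP.
by move=> _; rewrite -[a](subrK d) addrAC; apply: chartD.
Qed.

Let genD (D : set expo) (N : set (expo -> 'rV[k]_m)) n h :
  submod_gen D N n -> submod_gen D N h -> submod_gen D N (fun a => n a + h a).
Proof.
move=> gn gh; elim: gn => [|c d n1 h1 Dd Nn1 _ IH].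
  by under boolp.eq_fun do rewrite add0r.
by under boolp.eq_fun do rewrite -addrA; apply: submod_genS.
Qed.

Let gen_monomials (D : set expo) (N : set (expo -> 'rV[k]_m)) n :
  finsupp n -> (forall a, n a != 0 -> submod_gen D N (monomial a (n a))) ->
  submod_gen D N n.
Proof.
move=> /finite_seqP[r nr] gn.
suff H (t : seq expo) : uniq t ->
    submod_gen D N (fun b => if b \in t then n b else 0).
  have -> : n = (fun b => if b \in undup r then n b else 0).
    apply/boolp.funext => b; rewrite mem_undup; case: ifPn => // bNr.
    apply/eqP; apply: contraNT bNr => nb.
    by have : [set a | n a != 0]%classic b by []; rewrite nr.
  exact/H/undup_uniq.
elim: t => [_|a t IH /= /andP[aNt tu]].
  exact: submod_gen0.
have -> : (fun b => if b \in a :: t then n b else 0) =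
    (fun b => monomial a (n a) b + if b \in t then n b else 0).
  apply/boolp.funext => b; rewrite in_cons /monomial.
  by case: eqVneq => [->|_] /=; rewrite ?(negPf aNt) ?addr0 ?add0r.
have [na0|na] := eqVneq (n a) 0; last by apply: genD; [apply: gn|apply: IH].
rewrite /monomial na0.
by under boolp.eq_fun do rewrite if_same add0r; apply: IH.
Qed.

(* The vectors supported on the first [l] entries for the order [s]. *)
Let first s l (v : 'rV[k]_m) := forall p : 'I_m, (l <= p)%N -> v 0 (s p) = 0.

Let complement s : exists C : {vspace 'rV[k]_m}, (L :&: C = 0)%VS /\
  forall l v, first s l v -> exists x y,
    [/\ x \in L, y \in C, first s l x, first s l y & v = x + y].
Proof.
suff H n : (n <= m)%N -> exists C : {vspace 'rV[k]_m}, [/\ (L :&: C = 0)%VS,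
    forall y, y \in C -> first s n y &
    forall l v, (l <= n)%N -> first s l v -> exists x y,
      [/\ x \in L, y \in C, first s l x, first s l y & v = x + y]].
  have [C [LC _ HC]] := H m (leqnn m).
  exists C; split=> // l v; have [lm|/ltnW ml] := leqP l m; first exact: HC.
  move=> _; have [||x [y [xL yC _ _ ->]]] := HC m v => //.
    by move=> p; rewrite leqNgt ltn_ord.
  have triv z : first s l z by move=> p lp; move: (leq_trans ml lp); rewrite leqNgt ltn_ord.
  by exists x, y.
elim: n => [_|n IHn nm].
  exists 0%VS; split=> [|y|l v]; first exact: capv0.
    by rewrite memv0 => /eqP-> p _; rewrite mxE.
  rewrite leqn0 => /eqP-> v0; exists 0, 0.
  have z0 : first s 0 0 by move=> p _; rewrite mxE.
  split=> //; rewrite ?mem0v // addr0; apply/rowP => i.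
  by rewrite -[i](permKV s) v0 // mxE.
have [C [LC Cn HC]] := IHn (ltnW nm).
pose q := Ordinal nm; pose e : 'rV[k]_m := delta_mx 0 (s q).
have eE (p : 'I_m) : e 0 (s p) = (p == q)%:R.
  by rewrite mxE eqxx (inj_eq (@perm_inj _ s)).
have fS l l' v : (l <= l')%N -> first s l v -> first s l' v.
  by move=> ll' vl p l'p; apply: vl; apply: leq_trans l'p.
have fD l v w c : first s l v -> first s l w -> first s l (v + c *: w).
  by move=> vl wl p lp; rewrite !mxE vl // wl // mulr0 addr0.
have eS : first s n.+1 e.
  by move=> p np; rewrite eE; case: eqP => // pq; move: np; rewrite pq ltnn.
have split_e v : first s n.+1 v -> first s n (v - v 0 (s q) *: e).
  move=> vS p; rewrite leq_eqVlt => /predU1P[np|np].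
    have -> : p = q by apply/val_inj.
    by rewrite !mxE !eqxx mulr1 subrr.
  by rewrite -scaleNr; apply: (fD n.+1) => //; apply: eS.
have [[x [xL xe]]|noL] :=
    boolp.pselect (exists x, x \in L /\ first s n (e - x)).
  exists C; split=> // [y /Cn|l v]; first exact: fS.
  rewrite leq_eqVlt ltnS => /predU1P[->|ln]; last exact: HC.
  move=> vS; have [|x1 [y1 [x1L y1C x1f y1f E]]] :=
    HC n ((v - v 0 (s q) *: e) + v 0 (s q) *: (e - x)) (leqnn n).
    by apply: fD => //; apply: split_e.
  exists (x1 + v 0 (s q) *: x), y1; split=> //.
  - by rewrite rpredD ?rpredZ.
  - apply: (fD n.+1); first exact: fS x1f.
    rewrite (_ : x = e + (-1) *: (e - x)); last by rewrite scaleN1r opprB addrC subrK.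
    by apply: fD => //; apply: fS xe.
  - exact: fS y1f.
  by rewrite addrAC -E scalerBr addrA subrK subrK.
exists (C + <[e]>)%VS; split=> [|y|l v].
- apply/eqP; rewrite -subv0; apply/subvP => z; rewrite memv_cap memv0.
  case/andP=> zL /memv_addP[y yC [_ /vlineP[c ->] zE]].
  have [c0|c0] := eqVneq c 0.
    move: zE; rewrite c0 scale0r addr0 => zE.
    have : z \in (L :&: C)%VS by rewrite memv_cap zL zE.
    by rewrite LC memv0.
  case: noL; exists (c^-1 *: z); rewrite rpredZ //; split=> //.
  rewrite zE scalerDr scalerA mulVf // scale1r opprD addrCA subrr addr0.
  by move=> p np; rewrite !mxE (Cn _ yC) // mulr0 oppr0.
- case/memv_addP=> y1 y1C [_ /vlineP[c ->] ->].
  by apply: fD => //; apply: fS (Cn _ y1C).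
rewrite leq_eqVlt ltnS => /predU1P[->|ln vl]; last first.
  have [x [y [xL yC xl yl ->]]] := HC l v ln vl; exists x, y; split=> //.
  exact: (subvP (addvSl _ _)).
move=> vS; have [x [y [xL yC xl yl E]]] := HC n _ (leqnn n) (split_e v vS).
exists x, (y + v 0 (s q) *: e); split=> //.
- by rewrite memv_add // memvZ // memv_line.
- exact: fS xl.
- by apply: fD => //; apply: fS yl.
by rewrite addrA -E subrK.
Qed.

Let chart_mono s a (p p' : 'I_m) : (p <= p')%N ->
  chart_char s (a + delta (s p')) -> chart_char s (a + delta (s p)).
Proof.
move=> pp' H w ws; apply: le_trans (H w ws) _.
by rewrite !pairingD !pairing_delta lerD2l; apply: ws.
Qed.

Let part_monomial K s a f : f \in K ->
  (forall i, f 0 i != 0 -> chart_char s (a + delta i)) ->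
  part K s (monomial a f).
Proof.
move=> fK fP; split=> [|b]; last by rewrite /monomial; case: ifP => // _; apply: rpred0.
split=> [|i b].
  apply: (@sub_finite_set _ _ [set a]%classic) (finite_set1 a) => b /=.
  by rewrite /monomial; have [//|_] := eqVneq b a; case/eqP.
by rewrite /monomial; have [->|_] := eqVneq b a; [exact: fP | rewrite mxE; case/eqP].
Qed.

Let part_daddv s (X Y : {vspace 'rV[k]_m}) n : (X :&: Y = 0)%VS ->
  (forall l v, first s l v -> exists x y,
    [/\ x \in X, y \in Y, first s l x, first s l y & v = x + y]) ->
  standard_bundle k m s n -> part X s (fun a => daddv_pi X Y (n a)).
Proof.
move=> XY dec [nfin nP]; split=> [|a]; last exact: memv_pi.
split=> [|i a].
  apply: sub_finite_set nfin => a /=.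
  by apply: contraNN => /eqP->; rewrite linear0.
move=> nz; rewrite -[i](permKV s); set p := (s^-1)%g i.
apply: boolp.contrapT => Np; case/eqP: nz; rewrite -[i](permKV s) -/p.
have : first s p (n a).
  move=> p' pp'; apply/eqP; apply: contra_notT Np => /nP.
  exact: chart_mono.
move=> /dec[x [y [xX yY xf _ ->]]]; rewrite linearD /= (daddv_pi_id XY) //.
suff -> : daddv_pi X Y y = 0 by rewrite addr0; apply: xf.
have := daddv_pi_add XY (subvP (addvSr X Y) _ yY).
rewrite (@daddv_pi_id _ _ Y X) //; last by rewrite capvC.
by move/eqP; rewrite -subr_eq0 addrK => /eqP.
Qed.

Let overlap_eq s s' (w : expo) (p : 'I_m) :
  cone s w -> cone s' w -> w 0 (s p) = w 0 (s' p).
Proof.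
move=> ws ws'.
pose t (u : 'S_m) := [seq w 0 (u p) | p <- enum 'I_m].
have tsorted (u : 'S_m) : cone u w -> sorted >=%O (t u).
  move=> wu; rewrite /t sorted_map.
  have : sorted (relpre val leq) (enum 'I_m).
    by rewrite -sorted_map val_enum_ord iota_sorted.
  by apply: sub_sorted => i j; apply: wu.
have tperm (u : 'S_m) : perm_eq (t u) [seq w 0 i | i <- enum 'I_m].
  rewrite /t (map_comp (w 0) u); apply: perm_map.
  apply: uniq_perm; rewrite ?enum_uniq ?(map_inj_uniq (@perm_inj _ u)) ?enum_uniq //.
  move=> i; rewrite mem_enum; apply/mapP; exists (u^-1 i)%g; rewrite ?permKV //.
  by rewrite mem_enum.
have tE : t s = t s'.
  apply: (@sorted_eq _ >=%O) => //; last 3 first.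
  - exact: tsorted.
  - exact: tsorted.
  - by rewrite (perm_trans (tperm s)) // perm_sym.
  - by move=> a b c /= ba cb; apply: le_trans cb ba.
  - by move=> a b /= /andP[ba ab]; apply/eqP; rewrite eq_le ab ba.
have := congr1 (fun r => nth 0 r p) tE.
have E (u : 'S_m) : (t u)`_p = w 0 (u p).
  by rewrite /t (nth_map p) ?size_enum_ord // nth_ord_enum.
by rewrite !E.
Qed.

Lemma universal_subbundle_exists : exists S : sections m 'rV[k]_m,
  is_equivariant_subbundle (standard_bundle k m) S /\ has_fiber S L.
Proof.
exists (part L); split; first split.
- by move=> s n [].
- exact: part_gen.
- move=> s; have [C [LC dec]] := complement s; exists (part C s); split.
  + by move=> n [].
  + exact: part_gen.
  + move=> n [_ nL] [_ nC]; apply/boolp.funext => a; apply/eqP.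
    by rewrite -memv0 -LC memv_cap nL nC.
  move=> n nV; have CL : (C :&: L = 0)%VS by rewrite capvC.
  exists (fun a => daddv_pi L C (n a)), (fun a => daddv_pi C L (n a)); split.
  + exact: part_daddv.
  + apply: part_daddv => // l v /dec[x [y [xL yC xl yl ->]]].
    by exists y, x; split; rewrite // addrC.
  apply/boolp.funext => a; rewrite daddv_pi_add //.
  have [|x [y [xL yC _ _ ->]]] := dec m (n a); last by rewrite memv_add.
  by move=> p; rewrite leqNgt ltn_ord.
- move=> s s' n [[nfin nP] nL]; apply: gen_monomials => // a na.
  set f := n a in na *; have fL : f \in L by apply: nL.
  have [i0 fi0] : exists i, f 0 i != 0.
    apply/existsP; apply: contraNT na; rewrite negb_exists => /forallP f0.
    by apply/eqP/rowP => i; rewrite mxE; apply/eqP/negPn/f0.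
  pose last (u : 'S_m) := [arg max_(p > (u^-1)%g i0 | (f 0 (u p) != 0)%R) val p]%N.
  have lastP (u : 'S_m) : f 0 (u (last u)) != 0 /\
      forall i, f 0 i != 0 -> ((u^-1)%g i <= last u)%N.
    rewrite /last; case: arg_maxnP => [|p fp pmax]; first by rewrite permKV.
    by split=> // i fi; apply: pmax; rewrite permKV.
  have [jf jmax] := lastP s; have [jf' jmax'] := lastP s'.
  set j := s (last s) in jf; set j' := s' (last s') in jf'.
  pose c : expo := a + delta j.
  pose b : expo := \row_i c 0 (s ((s'^-1)%g i)) - delta j'.
  have pb (w : expo) : pairing (b + delta j') w =
      pairing c (\row_i w 0 (s' ((s^-1)%g i))).
    rewrite /b subrK /pairing (reindex_inj (@perm_inj _ s')) /=.
    rewrite [RHS](reindex_inj (@perm_inj _ s)) /=.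
    by apply: eq_bigr => p _; rewrite !mxE !permK.
  have -> : monomial a f =
      (fun x => 1 *: shift (a - b) (monomial b f) x + (fun=> 0) x).
    apply/boolp.funext => x; rewrite scale1r addr0 /shift /monomial.
    by rewrite subr_eq addrC subrK.
  apply: submod_genS; last exact: submod_gen0.
    move=> w [ws ws']; rewrite pairingD pairingN.
    have -> : pairing b w = pairing c w - w 0 j'.
      apply/eqP; rewrite -subr_eq opprK -pairing_delta -pairingD pb; apply/eqP.
      apply: eq_bigr => i _; rewrite !mxE.
      by rewrite -(overlap_eq _ ws ws') permKV.
    rewrite /c pairingD pairing_delta opprB addrA addrAC.
    rewrite opprD addrA subrr sub0r addrC subr_ge0.
    by rewrite -[j'](permKV s); apply: ws; apply: jmax.
  apply: part_monomial => // i fi w ws'.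
  have -> : pairing (b + delta i) w = pairing (b + delta j') w + (w 0 i - w 0 j').
    by rewrite (pairingD b (delta i)) (pairingD b (delta j')) !pairing_delta -addrA [w 0 j' + _]addrC subrK.
  apply: addr_ge0.
    rewrite pb; apply: (nP j) => // p p' pp'; rewrite !mxE !permK.
    exact: ws'.
  by rewrite subr_ge0 -[i](permKV s'); apply: ws'; apply: jmax'.
- move=> s n a [[_ nP] nL]; apply: part_monomial => // i; exact: nP.
move=> s f; split=> [fL|[n [_ nL] <-]]; last by apply: rpred_sum => a _.
have [a aP] : exists a, forall i, chart_char s (a + delta i).
  have [m0|m_gt0] := posnP m.
    by exists 0 => i; move: (leq_trans (ltn_ord i) (eq_leq m0)); rewrite ltn0.
  have lm : (m.-1 < m)%N by rewrite prednK.
  exists (- delta (s (Ordinal lm))) => i w ws.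
  rewrite pairingD pairingN !pairing_delta addrC subr_ge0 -[i](permKV s).
  by apply: ws => /=; rewrite -ltnS prednK.
exists (monomial a f); first exact: part_monomial.
rewrite /eval1 -(@fsbig_widen _ _ _ _ [set a]%classic) //=.
  by rewrite fsbig_set1 /monomial eqxx.
by move=> b [_ /= ba]; rewrite /monomial; case: eqP.
Qed.

End Existence.

(* Main.v *)
From HB Require Import structures.
Require Import Defs.
From mathcomp Require Import all_classical all_reals.
From mathcomp Require Import all_boot all_order all_algebra all_fingroup.
Import Order.TTheory GRing.Theory Num.Theory.
Local Open Scope ring_scope.

(** The tautological map [Phi] of a loop-free matroid is determined by its level sets:
   [d <= Phi w i] holds exactly if [i] lies in the closure of [{j | d <= w j}]
   ([le_tautological]). These level sets are flats, whence [Phi w] is in the Bergman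
   fan.

   The combinatorial heart is the notion of a greedy basis for a weight [w]: a basis
   [B] such that every [e] is in the closure of the elements of [B] that are at least
   as heavy as [e]. Such a basis has maximal weight ([greedy_max]), it is still greedy
   for [Phi w], and [Phi w] agrees with [w] on it, because an element [b] of [B] that
   were in the closure of the elements heavier than [b] would be in the closure of
   [B :\ b]. On the cone of a permutation [s] the lexicographically first basis for [s]
   is greedy for all [w] in it ([lex_basis_greedy]). Hence [Phi] maps this cone to a
   single apartment, on whose coordinates it is the identity; this proves that [Phi] is a
   tropical vector bundle and computes its Chern classes at once. The complement of a
   greedy basis for [w] is a greedy basis of the dual matroid for [- w]
   ([greedy_dual]), which gives the statements about the Cremona pull-back.

   For the tropicalizations, the limit of [z^-d lambda_x(z) . g] exists exactly if [g]
   is in the span of the [f i] with [d <= y i], where [y] is [x] for the dual universal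
   subbundle and [- x] for the universal quotient bundle ([dual_sub_limit],
   [quotient_limit]). As [f i] is in the span of a subfamily exactly if [i] is in its
   closure, the valuations of the [f i] are the entries of [Phi y]
   ([tropicalization_criterion]). For the quotient bundle, the sections are images of
   those of a sum of line bundles, and the bound on their coefficients is immediate.
   For the dual subbundle, a coefficient of a section is bounded by evaluating the
   section on [t^a v] with [v] in [L] and [a] as small as possible; that these are
   sections of the subbundle ([subbundle_monomial]) follows from its being a direct
   summand with fiber [L]. *)

Set Implicit Arguments.
Unset Strict Implicit.
Unset Printing Implicit Defensive.

(** * Closure in a matroid *)

Section Closure.
Variables (T : finType) (M : matroid T).
Implicit Types (A B C I J : {set T}) (e : T).

Lemma indepP I : reflect (exists2 B, B \in bases M & I \subset B) (indep M I).
Proof.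
apply: (iffP existsP) => [[B /andP[]]|[B Bb IB]]; first by exists B.
by exists B; rewrite Bb.
Qed.

Lemma basis_indep B : B \in bases M -> indep M B.
Proof. by move=> Bb; apply/indepP; exists B. Qed.

Lemma indepS I J : I \subset J -> indep M J -> indep M I.
Proof.
by move=> IJ /indepP[B Bb JB]; apply/indepP; exists B => //; apply: subset_trans JB.
Qed.

Lemma indep0 : indep M set0.
Proof. exact: indepS (sub0set _) (basis_indep (basis0P M)). Qed.

(** Among the bases that contain [I], one with fewest elements outside [B2] will do:
   any other element outside [B2] could be exchanged for one of [B2]. *)
Lemma basis_near I B2 : indep M I -> B2 \in bases M ->
  exists B1, [/\ B1 \in bases M, I \subset B1 & B1 \subset I :|: B2].
Proof.
move=> /indepP[B0 B0b IB0] B2b.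
pose P B := (B \in bases M) && (I \subset B).
have P0 : P B0 by rewrite /P B0b.
case: (arg_minnP (fun B => #|B :\: B2|) P0) => B /andP[Bb IB] minB.
exists B; split=> //; apply/subsetP => z zB; rewrite inE; apply/norP => -[zI zB2].
have [|y] := bases_exchange Bb B2b (x := z); first by rewrite inE zB2.
rewrite inE => /andP[yB yB2] B'b.
have /minB : P (y |: (B :\ z)).
  rewrite /P B'b; apply/subsetP => u uI; rewrite !inE (subsetP IB) // andbT.
  by apply/orP; right; apply: contraNneq zI => <-.
rewrite leqNgt => /negP[]; apply: proper_card; apply/properP; split.
  apply/subsetP => u; rewrite !inE => /andP[uN]; rewrite uN /=.
  by case: eqVneq uN => [->|_ _ /= /andP[]//]; rewrite yB2.
exists z; rewrite !inE ?zB2 // eqxx /= orbF.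
by apply: contraNneq yB => <-.
Qed.

(** Extend [I] to a basis [B1] by elements of a basis [B2] that contains [J]. If none of
   these were in [J], then [B1 :\: I] would be contained in the smaller set
   [B2 :\: J]. *)
Lemma indep_augment I J : indep M I -> indep M J -> (#|I| < #|J|)%N ->
  exists2 y, y \in J :\: I & indep M (y |: I).
Proof.
move=> Ii /indepP[B2 B2b JB2] ltIJ.
have [B1 [B1b IB1 B1s]] := basis_near Ii B2b.
have [/eqP D0|/set0Pn[y]] := boolP ((B1 :\: I) :&: J == set0); last first.
  rewrite !inE => /andP[/andP[yI yB1] yJ]; exists y; first by rewrite inE yI.
  by apply/indepP; exists B1 => //; rewrite subUset sub1set yB1.
suff: (#|B1 :\: I| <= #|B2 :\: J|)%N.
  rewrite !cardsD (setIidPr IB1) (setIidPr JB2) (card_basis B1b B2b) leqNgt.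
  by rewrite ltn_sub2l // (leq_trans ltIJ) // subset_leq_card.
apply/subset_leq_card/subsetP => u; rewrite !inE => /andP[uI uB1].
move: (subsetP B1s _ uB1); rewrite !inE (negPf uI) /= => ->; rewrite andbT.
by apply/negP => uJ; move/setP/(_ u): D0; rewrite !inE uI uB1 uJ.
Qed.

(** Independent sets of maximal size in [A] are the same as the inclusion-maximal ones;
   the latter form is the one available to exchange arguments. *)
Definition basis_of_set A I :=
  [/\ I \subset A, indep M I & forall e, e \in A -> e \notin I -> ~~ indep M (e |: I)].

Lemma leq_rank A I : I \subset A -> indep M I -> (#|I| <= rank M A)%N.
Proof. by move=> IA Ii; rewrite /rank (bigD1 I) ?IA //= leq_maxl. Qed.

Lemma rank_basis_of A I : basis_of_set A I -> rank M A = #|I|.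
Proof.
move=> [IA Ii Imax]; apply/eqP; rewrite eqn_leq leq_rank // andbT.
apply/bigmax_leqP => J /andP[JA Ji]; rewrite leqNgt; apply/negP => ltIJ.
have [y] := indep_augment Ii Ji ltIJ; rewrite inE => /andP[yI yJ].
by apply/negP/Imax => //; apply: subsetP yJ.
Qed.

Lemma basis_of_extend A I : I \subset A -> indep M I ->
  exists2 J, basis_of_set A J & I \subset J.
Proof.
move=> IA Ii.
pose P J := [&& J \subset A, indep M J & I \subset J].
have P0 : P I by rewrite /P IA Ii /=.
case: (arg_maxnP (fun J => #|J|) P0) => J /and3P[JA Ji IJ] Jmax.
exists J => //; split=> // e eA eJ; apply/negP => eJi.
have /Jmax : P (e |: J).
  by rewrite /P subUset sub1set eA JA eJi /= (subset_trans IJ) // subsetUr.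
by rewrite /= cardsU1 eJ ltnn.
Qed.

Lemma basis_of_exists A : exists J, basis_of_set A J.
Proof. by have [J JA _] := basis_of_extend (sub0set A) indep0; exists J. Qed.

(** One maximal independent subset [I] of [A] decides membership in the closure. It is
   also maximal in the closure of [A], which is why the closure is idempotent. *)
Lemma mspanE A I e : basis_of_set A I ->
  (e \in mspan M A) = (e \in I) || ~~ indep M (e |: I).
Proof.
move=> IA; have [sIA Ii Imax] := IA; rewrite inE (rank_basis_of IA).
have [eA|eA] := boolP (e \in A).
  rewrite (setUidPr _) ?sub1set // (rank_basis_of IA) eqxx.
  by have [//|eI] := boolP (e \in I); rewrite Imax.
have eI : e \notin I by apply: contra eA; apply: subsetP.
rewrite (negPf eI) /=; have [ei|ed] := boolP (indep M (e |: I)).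
  apply/negbTE; rewrite neq_ltn; apply/orP; right.
  by have /leq_rank /(_ ei) := setUS [set e] sIA; rewrite cardsU1 eI.
rewrite (@rank_basis_of _ I) ?eqxx //; split=> // [|x].
  exact: subset_trans sIA (subsetUr _ _).
by rewrite !inE => /predU1P[->//|]; apply: Imax.
Qed.

Lemma sub_mspan A : A \subset mspan M A.
Proof. by apply/subsetP => e eA; rewrite inE (setUidPr _) ?sub1set. Qed.

Lemma mspanS A B : A \subset B -> mspan M A \subset mspan M B.
Proof.
move=> AB; have [I IA] := basis_of_exists A; have [sIA Ii _] := IA.
have [J JB IJ] := basis_of_extend (subset_trans sIA AB) Ii.
apply/subsetP => e; rewrite (mspanE _ IA) (mspanE _ JB) => /orP[/(subsetP IJ)->//|].
move=> eI; apply/orP; right; apply: contra eI; apply: indepS; exact: setUS.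
Qed.

Lemma mspanK A : mspan M (mspan M A) = mspan M A.
Proof.
have [I IA] := basis_of_exists A; have [sIA Ii _] := IA.
have IsA : basis_of_set (mspan M A) I.
  split=> // [|e]; first exact: subset_trans sIA (sub_mspan A).
  by rewrite (mspanE _ IA) => /orP[->|].
by apply/setP => e; rewrite (mspanE _ IA) (mspanE _ IsA).
Qed.

Lemma mspan_trans A B : A \subset mspan M B -> mspan M A \subset mspan M B.
Proof. by move=> /mspanS; rewrite mspanK. Qed.

Lemma mem_mspan_indep I e : indep M I ->
  (e \in mspan M I) = (e \in I) || ~~ indep M (e |: I).
Proof. by move=> Ii; apply: mspanE; split=> // x ->. Qed.

Lemma card_indep_basis I B : indep M I -> B \in bases M -> (#|B| <= #|I|)%N ->
  I \in bases M.
Proof.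
move=> /indepP[B1 B1b IB1] Bb le; suff -> : I = B1 by [].
by apply/eqP; rewrite eqEcard IB1 (card_basis B1b Bb).
Qed.

Lemma mspan_basis B e : B \in bases M -> e \in mspan M B.
Proof.
move=> Bb; rewrite (mem_mspan_indep _ (basis_indep Bb)).
have [//|eB] /= := boolP (e \in B).
apply/negP => /indepP[B1 B1b /subset_leq_card].
by rewrite cardsU1 eB (card_basis B1b Bb) ltnn.
Qed.

Lemma indep_spanning_basis I : indep M I -> (forall e, e \in mspan M I) -> I \in bases M.
Proof.
move=> Ii full; have /indepP[B Bb IB] := Ii; suff -> : I = B by [].
apply/eqP; rewrite eqEsubset IB; apply/subsetP => b bB; move: (full b).
rewrite mem_mspan_indep // => /orP[//|/negP[]].
by apply: indepS (basis_indep Bb); rewrite subUset sub1set bB.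
Qed.

Lemma indep_mspanD1 I e : indep M I -> e \in I -> e \notin mspan M (I :\ e).
Proof.
move=> Ii eI; rewrite mem_mspan_indep; last exact: indepS (subD1set _ _) Ii.
by rewrite setD1K // !inE eqxx /= Ii.
Qed.

(** Exchange in terms of the closure: unlike in the exchange property of bases, the
   entering element [y] can be prescribed. *)
Lemma basis_swap B x y : B \in bases M -> x \in B -> y \notin mspan M (B :\ x) ->
  y |: (B :\ x) \in bases M.
Proof.
move=> Bb xB; have Bxi := indepS (subD1set B x) (basis_indep Bb).
rewrite mem_mspan_indep // negb_or negbK => /andP[yBx yi].
by apply: card_indep_basis yi Bb _; rewrite cardsU1 yBx (cardsD1 x B) xB.
Qed.

Lemma circuit_mspan C e : circuit M C -> e \in C -> e \in mspan M (C :\ e).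
Proof.
move=> /andP[Cd /forallP/(_ e)] + eC; rewrite eC /= => Cei.
by rewrite mem_mspan_indep // setD1K // Cd orbT.
Qed.

Lemma dep_circuit A : ~~ indep M A -> exists2 C, circuit M C & C \subset A.
Proof.
move=> Ad; pose P C := ~~ indep M C && (C \subset A).
have P0 : P A by rewrite /P Ad /=.
case: (arg_minnP (fun C => #|C|) P0) => C /andP[Cd CA] Cmin.
exists C => //; rewrite /circuit Cd; apply/forallP => e; apply/implyP => eC.
apply: contraT => Ced; have /Cmin : P (C :\ e).
  by rewrite /P Ced (subset_trans (subD1set _ _) CA).
by rewrite /= (cardsD1 e C) eC ltnn.
Qed.

Lemma loop_free_mspan0 : loop_free M -> mspan M set0 = set0.
Proof.
move=> /forallP lf; apply/setP => e; rewrite (mem_mspan_indep _ indep0).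
by rewrite setU0 lf !inE.
Qed.
End Closure.

Lemma mdual_basisE (T : finType) (M : matroid T) B :
  (B \in bases (mdual M)) = (~: B \in bases M).
Proof.
apply/imsetP/idP => [[B' B'b ->]|Bb]; first by rewrite setCK.
by exists (~: B); rewrite ?setCK.
Qed.

Lemma mdual_indepP (T : finType) (M : matroid T) (I : {set T}) :
  reflect (exists2 B, B \in bases M & [disjoint B & I]) (indep (mdual M) I).
Proof.
apply: (iffP (@indepP _ (mdual M) I)) => -[B Bb sI]; exists (~: B).
- by rewrite -mdual_basisE.
- by rewrite disjoint_sym disjoints_subset setCK.
- by rewrite mdual_basisE setCK.
- by rewrite -disjoints_subset disjoint_sym.
Qed.

(** * Greedy bases *)

Section Greedy.
Variables (R : realDomainType) (m : nat) (M : matroid 'I_m).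
Implicit Types (w : 'rV[R]_m) (B C : {set 'I_m}).

(** The output of the greedy algorithm for the weight [w], described without choosing
   an order of the ground set that refines [w]. *)
Definition greedy w B := B \in bases M /\
  forall e, e \in mspan M [set b in B | w 0 e <= w 0 b].

(** An element [x] of [B' :\: B] can be replaced by an element of [B] that is at least
   as heavy, which does not make [B'] lighter and brings it closer to [B]. *)
Lemma greedy_max w B B' : greedy w B -> B' \in bases M ->
  \sum_(b in B') w 0 b <= \sum_(b in B) w 0 b.
Proof.
move=> [Bb Bg]; have [n] := ubnP #|B' :\: B|; elim: n B' => // n IHn B' ltn B'b.
have [D0|/set0Pn[x]] := eqVneq (B' :\: B) set0.
  suff -> : B' = B by [].
  by apply/eqP; rewrite eqEcard -setD_eq0 D0 eqxx (card_basis Bb B'b) /=.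
rewrite inE => /andP[xB xB'].
(* The elements of [B] that are not lighter than [x] span [x], so they are not
   all spanned by [B' :\ x]. *)
have [y yBx yB'] : exists2 y, y \in [set b in B | w 0 x <= w 0 b] &
    y \notin mspan M (B' :\ x).
  apply/subsetPn; apply: contra (indep_mspanD1 (basis_indep B'b) xB').
  by move=> /mspan_trans/subsetP; apply; apply: Bg.
move: yBx; rewrite inE => /andP[yB wxy].
have yx : y != x by apply: contraNneq xB => <-.
have yNB' : y \notin B'.
  by apply: contra yB' => yB'; apply: (subsetP (sub_mspan _ _)); rewrite !inE yx.
have B''b := basis_swap B'b xB' yB'.
apply: le_trans (IHn _ _ B''b); last first.
  move: ltn; rewrite ltnS; apply: leq_trans; apply: proper_card; apply/properP; split.
    apply/subsetP => u; rewrite !inE => /andP[uB]; rewrite uB /=.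
    by case: eqVneq uB => [->|_ _ /= /andP[]//]; rewrite yB.
  by exists x; rewrite !inE ?xB // eqxx /= orbF (eq_sym x) (negPf yx).
by rewrite (big_setD1 x) //= big_setU1 ?inE ?(negPf yNB') ?andbF //= lerD2r.
Qed.
End Greedy.

(** For [e] in [B], an independent set of the dual that refutes the claim is disjoint
   from a basis [B1] of [M], which consists of elements heavier than [e], all of them
   spanned by [B :\ e], and of elements of [B :\ e]; so [B1] would not span [e]. *)
Lemma greedy_dual (R : realDomainType) m (M : matroid 'I_m) (w : 'rV[R]_m) B :
  greedy M w B -> greedy (mdual M) (- w) (~: B).
Proof.
move=> [Bb Bg]; split=> [|e]; first by rewrite mdual_basisE setCK.
set A := [set b in ~: B | _].
have [eB|eB] := boolP (e \in B); last first.
  by apply: (subsetP (sub_mspan _ _)); rewrite !inE eB lexx.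
apply/negPn/negP; rewrite mem_mspan_indep; last first.
  apply/mdual_indepP; exists B => //; rewrite disjoint_sym disjoints_subset.
  by apply/subsetP => x; rewrite inE => /andP[].
rewrite negb_or negbK => /andP[_ /mdual_indepP[B1 B1b dis]].
have /negP[] := indep_mspanD1 (basis_indep Bb) eB.
apply: (subsetP (mspan_trans _)) (mspan_basis e B1b).
apply/subsetP => x xB1; move: (disjointFr dis xB1).
rewrite in_setU1 inE in_setC !mxE lerN2.
move=> /norP[xe]; rewrite negb_and negbK => /orP[xB|].
  by apply: (subsetP (sub_mspan _ _)); rewrite !inE xe.
rewrite -ltNge => wex; apply: (subsetP (mspanS _ _)) (Bg x).
apply/subsetP => b; rewrite !inE => /andP[-> wxb]; rewrite andbT.
by apply: contraTneq wxb => ->; rewrite -ltNge.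
Qed.

(** * Lexicographically first bases *)

Lemma lexi_catF (l a b : seq nat) (x : nat) : b != [::] -> all (ltn x) b ->
  ((l ++ b : seqlexi nat) <= (l ++ x :: a : seqlexi nat))%O = false.
Proof.
move=> b0 xb; elim: l => [|y l IH] /=; last by rewrite lexi_cons lexx /= IH.
case: b b0 xb => //= y b _ /andP[xy _].
by rewrite lexi_cons leEnat leqNgt xy.
Qed.

Lemma filter_enum_split m (P : pred 'I_m) (i : 'I_m) :
  filter P (enum 'I_m) = filter P (take i (enum 'I_m)) ++
    (if P i then [:: i] else [::]) ++ filter P (drop i.+1 (enum 'I_m)).
Proof.
rewrite -[in LHS](cat_take_drop i (enum 'I_m)) (drop_nth i) ?size_enum_ord //.
by rewrite nth_ord_enum filter_cat /=; case: (P i).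
Qed.

Lemma mem_take_enum m (i j : 'I_m) : (j \in take i (enum 'I_m)) = (j < i)%N.
Proof.
rewrite -(mem_map val_inj) map_take val_enum_ord take_iota mem_iota /=.
by rewrite add0n ltn_min ltn_ord andbT.
Qed.

Lemma mem_drop_enum m (i j : 'I_m) : (j \in drop i.+1 (enum 'I_m)) = (i < j)%N.
Proof.
rewrite -(mem_map val_inj) map_drop val_enum_ord drop_iota mem_iota /= add0n.
by case: ltnP => //= ij; rewrite subnKC ?ltn_ord.
Qed.

Section LexBasis.
Variables (m : nat) (M : matroid 'I_m) (s : 'S_m).
Implicit Types (B : {set 'I_m}).

Lemma lex_basisP : lex_basis M s \in bases M /\
  forall B, B \in bases M -> (lex_key s (lex_basis M s) <= lex_key s B)%O.
Proof.
rewrite /lex_basis; case: arg_minP => [|B Bb Bmin]; first exact: basis0P.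
by split=> // B'; apply: Bmin.
Qed.

(** Otherwise [e] extends the part of [B] that precedes it to an independent set; a
   basis between that set and [e |: B] comes before [B], as it first differs from [B]
   at [e]. *)
Lemma lex_basis_span e :
  e \in mspan M [set b in lex_basis M s | ((s^-1)%g b <= (s^-1)%g e)%N].
Proof.
set B := lex_basis M s; have [Bb Bmin] := lex_basisP; rewrite -/B in Bb Bmin.
set I := finset _; have Ii : indep M I.
  by apply: indepS (basis_indep Bb); apply/subsetP => b; rewrite inE => /andP[].
apply: contraT; rewrite mem_mspan_indep // negb_or negbK => /andP[eI eIi].
have eB : e \notin B by apply: contra eI => eB; rewrite inE eB leqnn.
have [B1 [B1b IB1 B1s]] := basis_near eIi Bb.
have eB1 : e \in B1 by apply: (subsetP IB1); rewrite setU11.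
pose p := (s^-1)%g e; have sp : s p = e by rewrite permKV.
have [b bB bB1] : exists2 b, b \in B & b \notin B1.
  apply/subsetPn; apply: contra eB => BB1.
  by have /eqP-> : B == B1 by rewrite eqEcard BB1 (card_basis B1b Bb) /=.
have pb : (p < (s^-1)%g b)%N.
  rewrite ltnNge; apply: contra bB1 => bp; apply: (subsetP IB1).
  by rewrite !inE bB bp orbT.
have := Bmin _ B1b; rewrite /lex_key !(filter_enum_split _ p) sp eB1 (negPf eB).
rewrite (@eq_in_filter _ (fun q => s q \in B1) (fun q => s q \in B)) => [|q].
  rewrite !map_cat /= lexi_catF //.
    rewrite -size_eq0 size_map size_filter -lt0n -has_count; apply/hasP.
    by exists ((s^-1)%g b); rewrite ?mem_drop_enum ?permKV.
  by rewrite all_map; apply/allP => q; rewrite mem_filter mem_drop_enum => /andP[].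
rewrite mem_take_enum => qp; apply/idP/idP => [/(subsetP B1s)|qB].
  rewrite !inE permK => /orP[/orP[/eqP qe|/andP[]//]|//].
  by move: qp; rewrite /p -qe permK ltnn.
by apply: (subsetP IB1); rewrite !inE permK qB (ltnW qp) orbT.
Qed.

Lemma lex_basis_greedy (R : realDomainType) (w : 'rV[R]_m) :
  cone s w -> greedy M w (lex_basis M s).
Proof.
move=> ws; split=> [|e]; first by case: lex_basisP.
apply: (subsetP (mspanS _ _)) (lex_basis_span e); apply/subsetP => b.
by rewrite !inE => /andP[-> /ws]; rewrite !permKV.
Qed.
End LexBasis.

(** * The tautological map *)

(** A nonempty level set [A] of [y] is the level set at the least [y j] with [j] in [A]. So
   the largest [d] at which the level set has a property that the empty set lacks is an
   entry of [y]. *)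
Lemma top_level (K : realDomainType) m (y : 'rV[K]_m) (P : pred {set 'I_m}) d :
  ~~ P set0 -> P [set j | d <= y 0 j]%SET ->
  exists j0, P [set j | y 0 j0 <= y 0 j]%SET /\
    forall d', P [set j | d' <= y 0 j]%SET -> d' <= y 0 j0.
Proof.
move=> P0; have down d' : P [set j | d' <= y 0 j]%SET ->
    exists2 j0, P [set j | y 0 j0 <= y 0 j]%SET & d' <= y 0 j0.
  move=> Pd'; have [E|/set0Pn[j1 j1P]] := eqVneq [set j | d' <= y 0 j]%SET set0.
    by move: P0; rewrite -E Pd'.
  rewrite inE in j1P.
  case: (@arg_minP _ _ _ j1 (fun j => d' <= y 0 j) (fun j => y 0 j) j1P).
  move=> j0 dj0 j0min; exists j0 => //.
  congr (P _): Pd'; apply/setP => j; rewrite !inE.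
  by apply/idP/idP => [/j0min|]; last exact: le_trans.
move=> /down[j1 j1P _].
case: (@arg_maxP _ _ _ j1 (fun j0 => P [set j | y 0 j0 <= y 0 j]%SET)
  (fun j => y 0 j) j1P) => j0 j0P j0max.
by exists j0; split=> // d' /down[j2 /j0max/= j20 dj2]; apply: le_trans j20.
Qed.

Section Tautological.
Variables (R : realType) (m : nat) (M : matroid 'I_m) (lf : loop_free M).
Implicit Types (w : 'rV[R]_m) (B C : {set 'I_m}).
Local Notation Phi := (tautological_map R M).

(** As [M] has no loops, the set of which [Phi w i] is the supremum is bounded by the
   entries of [w], and [top_level] provides its largest element. *)
Lemma tautological_spec w i : exists j, Phi w 0 i = w 0 j /\
  forall d, (d <= Phi w 0 i) = (i \in mspan M [set j | d <= w 0 j]%SET).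
Proof.
have [||j [jP jmax]] := @top_level _ _ w (fun A => i \in mspan M A) (w 0 i).
- by rewrite loop_free_mspan0 // in_set0.
- by apply: (subsetP (sub_mspan _ _)); rewrite inE lexx.
exists j; suff E : Phi w 0 i = w 0 j.
  rewrite E; split=> // d; apply/idP/idP => [dj|/jmax//].
  apply: (subsetP (mspanS _ _)) jP; apply/subsetP => l; rewrite !inE.
  exact: le_trans.
rewrite mxE; apply/eqP; rewrite eq_le; apply/andP; split.
  by apply: ge_sup; [exists (w 0 j) | move=> d /jmax].
by apply: ub_le_sup => //; exists (w 0 j) => d /jmax.
Qed.

Lemma le_tautological w d i :
  (d <= Phi w 0 i) = (i \in mspan M [set j | d <= w 0 j]%SET).
Proof. by have [j []] := tautological_spec w i. Qed.

Lemma tautological_ge w i : w 0 i <= Phi w 0 i.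
Proof. by rewrite le_tautological; apply: (subsetP (sub_mspan _ _)); rewrite inE. Qed.

(** The level sets of [Phi w] are flats, and a flat that contains all but one element
   of a circuit contains the circuit. *)
Lemma tautological_berg w : berg M (Phi w).
Proof.
move=> C Cc; have [e eC] : exists e, e \in C.
  apply/set0Pn; apply: contraTneq Cc => ->.
  by rewrite /circuit indep0.
case: (@arg_minP _ _ _ e [in C] (fun i => Phi w 0 i) eC) => i iC imin.
have [f fC] : exists f, f \in C :\ i.
  apply/set0Pn; apply: contraTneq (circuit_mspan Cc iC) => ->.
  by rewrite loop_free_mspan0 // in_set0.
case: (@arg_minP _ _ _ f [in C :\ i] (fun i => Phi w 0 i) fC) => j.
rewrite /= in_setD1 => /andP[ji jC] jmin.
exists i, j; split=> //; first by rewrite eq_sym.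
apply/eqP; rewrite eq_le imin //= le_tautological.
apply: (subsetP (mspan_trans _)) (circuit_mspan Cc iC).
by apply/subsetP => l lC; rewrite -le_tautological; apply: jmin.
Qed.

Lemma tautological_integral w : integral w -> integral (Phi w).
Proof. by move=> wi i; have [j [-> _]] := tautological_spec w i. Qed.

(** If [d > w 0 b] then the elements of weight at least [d] are spanned by elements of
   [B] other than [b]. *)
Lemma tautological_greedy_eq w B b : greedy M w B -> b \in B -> Phi w 0 b = w 0 b.
Proof.
move=> [Bb Bg] bB; apply/eqP; rewrite eq_le tautological_ge andbT leNgt.
apply: contra (indep_mspanD1 (basis_indep Bb) bB) => lt.
have := lexx (Phi w 0 b); rewrite le_tautological => /(subsetP (mspan_trans _)).
apply; apply/subsetP => j; rewrite inE => wj.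
apply: (subsetP (mspanS _ _)) (Bg j); apply/subsetP => c.
rewrite !inE => /andP[-> jc]; rewrite andbT.
by apply: contraTneq (lt_le_trans lt (le_trans wj jc)) => ->; rewrite ltxx.
Qed.

Lemma tautological_greedy w B : greedy M w B -> greedy M (Phi w) B.
Proof.
move=> [Bb Bg]; split=> // e; have := lexx (Phi w 0 e); rewrite le_tautological.
apply/(subsetP (mspan_trans _))/subsetP => j; rewrite inE => wj.
apply: (subsetP (mspanS _ _)) (Bg j); apply/subsetP => b.
rewrite !inE => /andP[-> /= jb]; apply: le_trans (tautological_ge w b).
exact: le_trans jb.
Qed.

Lemma tautological_apartment w B : greedy M w B -> apartment M B (Phi w).
Proof.
move=> /tautological_greedy gB; split; first exact: tautological_berg.
by move=> B'; apply: greedy_max.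
Qed.

Lemma tautological_tropical_bundle : tropical_bundle M Phi.
Proof.
split; [exact: tautological_berg | exact: tautological_integral |].
move=> _ [s [J ->]]; exists (lex_basis M s); first by case: (lex_basisP M s).
split=> [w [ws _]|]; first exact/tautological_apartment/lex_basis_greedy.
exists idfun => w [ws _] b bB.
exact: tautological_greedy_eq (lex_basis_greedy _ ws) bB.
Qed.

Lemma chern_greedy w B i : greedy M w B -> tropical_chern M Phi i w = Defs.esym w B i.
Proof.
move=> gB; rewrite /tropical_chern (esym_bergE i gB.1 (tautological_apartment gB)).
rewrite /Defs.esym; apply: eq_bigr => I /andP[/subsetP IB _].
by apply: eq_bigr => b /IB bB; rewrite (tautological_greedy_eq gB bB).
Qed.
End Tautological.

(** * The Cremona map *)

Section CremonaCone.
Variables (K : numDomainType) (m : nat).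

Lemma cremona_permE (s : 'S_m) i : cremona_perm s i = s (rev_ord i).
Proof. by rewrite permM permE. Qed.

Lemma cone_cremona (s : 'S_m) (w : 'rV[K]_m) : cone s w -> cone (cremona_perm s) (- w).
Proof.
by move=> ws i j ij; rewrite !mxE lerN2 !cremona_permE; apply: ws; apply: leq_sub2l.
Qed.
End CremonaCone.

Lemma cone_exists (K : realDomainType) m (w : 'rV[K]_m) : exists s, cone s w.
Proof.
pose r (i j : 'I_m) := w 0 j <= w 0 i.
have rtot : total r by move=> i j; apply: le_total.
have rtr : transitive r by move=> i j l ji lj; apply: le_trans lj ji.
have /tuple_permP[s sE] : perm_eq (sort r (ord_tuple m)) (ord_tuple m).
  by rewrite perm_sort.
exists s => i j ij; rewrite -/(r (s i) (s j)).
have nthE (l : 'I_m) : nth i (sort r (ord_tuple m)) l = s l.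
  by rewrite sE -tnth_nth tnth_mktuple tnth_ord_tuple.
have sz : size (sort r (ord_tuple m)) = m by rewrite size_sort size_tuple.
have := sorted_leq_nth rtr _ i (sort_sorted rtot (ord_tuple m)) i j.
rewrite !inE sz !ltn_ord !nthE.
by apply=> // l; apply: lexx.
Qed.

Lemma cremona_tropical_bundle (R : realType) m (M : matroid 'I_m) : loop_free M ->
  tropical_bundle M (pull_cremona (tautological_map R M)).
Proof.
move=> lf; split=> [w|w wi|_ [s [J ->]]].
- exact: tautological_berg.
- by apply: tautological_integral => // i; rewrite mxE rpredN.
exists (lex_basis M (cremona_perm s)); first by case: (lex_basisP M (cremona_perm s)).
split=> [w [/cone_cremona ws _]|].
  exact/tautological_apartment/lex_basis_greedy.
exists (-%R) => w [/cone_cremona ws _] b bB.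
exact: tautological_greedy_eq (lex_basis_greedy _ ws) bB.
Qed.

(** * Linear matroids *)

Section Family.
Variables (k : fieldType) (E : vectType k) (m : nat) (f : 'I_m -> E).
Implicit Types (A I : {set 'I_m}) (g : E) (M : matroid 'I_m).

Definition span_on A := <<[seq f i | i <- enum A]>>%VS.

Lemma mem_span_on A i : i \in A -> f i \in span_on A.
Proof. by move=> iA; apply/memv_span/map_f; rewrite mem_enum. Qed.

Lemma span_on_sub A (U : {vspace E}) : (forall i, i \in A -> f i \in U) ->
  (span_on A <= U)%VS.
Proof.
by move=> fU; apply/span_subvP => _ /mapP[i iA ->]; apply: fU; rewrite -mem_enum.
Qed.

Lemma span_onS A I : A \subset I -> (span_on A <= span_on I)%VS.
Proof. by move=> /subsetP AI; apply: span_on_sub => i /AI; apply: mem_span_on. Qed.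

Lemma span_onP A g :
  reflect (exists c : 'I_m -> k, g = \sum_(i in A) c i *: f i) (g \in span_on A).
Proof.
rewrite /span_on span_def big_map big_enum /=.
apply: (iffP memv_sumP) => [[v vA ->]|[c ->]]; last first.
  by exists (fun i => c i *: f i) => // i _; apply: rpredZ; apply: memv_line.
have fc i : {c | i \in A -> v i = c *: f i}.
  by have [/vA/vlineP/sig_eqW[c ->]|_] := boolP (i \in A); [exists c | exists 0].
by exists (fun i => sval (fc i)); apply: eq_bigr => i; apply: (svalP (fc i)).
Qed.

Lemma span_on0 : span_on set0 = 0%VS.
Proof. by rewrite /span_on enum_set0 span_nil. Qed.

Lemma free_on_setU1 I i : i \notin I -> free [seq f j | j <- enum (i |: I)] =
  (f i \notin span_on I) && free [seq f j | j <- enum I].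
Proof.
move=> iI; rewrite -free_cons; apply/perm_free; rewrite -map_cons perm_map //.
apply: uniq_perm; rewrite /= ?enum_uniq // ?mem_enum ?iI // => j.
by rewrite in_cons !mem_enum !inE.
Qed.

Lemma free_onP I : reflect
  (forall c : 'I_m -> k, \sum_(i in I) c i *: f i = 0 -> forall i, i \in I -> c i = 0)
  (free [seq f i | i <- enum I]).
Proof.
have [n] := ubnP #|I|; elim: n I => // n IHn I ltn.
have [->|[i iI]] := set_0Vmem I.
  rewrite enum_set0 nil_free; apply: ReflectT => c _ i; by rewrite inE.
have /IHn IH : (#|I :\ i| < n)%N by move: ltn; rewrite (cardsD1 i I) iI.
have -> : free [seq f j | j <- enum I] =
    (f i \notin span_on (I :\ i)) && free [seq f j | j <- enum (I :\ i)].
  by rewrite -free_on_setU1 ?setD1K // !inE eqxx.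
apply: (iffP andP) => [[fi /IH fr] c|fc].
  rewrite (big_setD1 i) //=; have [c0|c0] := eqVneq (c i) 0.
    rewrite c0 scale0r add0r => /fr cr j jI; have [->//|ji] := eqVneq j i.
    by apply: cr; rewrite !inE ji.
  move=> E0; case/negP: fi; apply/span_onP.
  exists (fun j => - (c i)^-1 * c j).
  under eq_bigr do rewrite -scalerA; rewrite -scaler_sumr.
  move/eqP: E0; rewrite addrC addr_eq0 => /eqP->.
  by rewrite scalerN scaleNr opprK scalerA mulVf // scale1r.
split; last first.
  apply/IH => c E0 j; rewrite !inE => /andP[ji jI].
  pose c' j := if j == i then 0 else c j.
  have := fc c' _ j jI; rewrite /c' (negPf ji); apply.
  rewrite (big_setD1 i) //= eqxx scale0r add0r -[RHS]E0; apply: eq_bigr => l.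
  by rewrite !inE => /andP[/negPf->].
apply/span_onP => -[c E0].
have := fc (fun j => if j == i then -1 else c j) _ i iI; rewrite eqxx => H.
have /eqP : -1 = 0 :> k.
  apply: H; rewrite (big_setD1 i) //= eqxx scaleN1r E0 addrC; apply/eqP.
  rewrite subr_eq0; apply/eqP/eq_bigr => l; by rewrite !inE => /andP[/negPf->].
by rewrite oppr_eq0 oner_eq0.
Qed.

(** A maximal independent subfamily of [A] spans the same subspace as [A]. *)
Lemma mspan_linear M A i : is_linear_matroid f M ->
  (i \in mspan M A) = (f i \in span_on A).
Proof.
move=> lin; have [I IA] := basis_of_exists M A; have [sIA Ii Imax] := IA.
have dep j : (f j \in span_on I) = (j \in I) || ~~ indep M (j |: I).
  have [jI|jI] /= := boolP (j \in I); first exact: mem_span_on.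
  by rewrite lin free_on_setU1 // -lin Ii andbT negbK.
rewrite (mspanE _ IA) -dep; suff -> : span_on A = span_on I by [].
apply/eqP; rewrite eqEsubv (span_onS sIA) andbT.
apply: span_on_sub => j jA; rewrite dep; have [//|jI] := boolP (j \in I).
exact: Imax.
Qed.

Lemma linear_neq0 M i : is_linear_matroid f M -> loop_free M -> f i != 0.
Proof.
move=> lin /forallP/(_ i); rewrite -[X in indep _ X]setU0 lin free_on_setU1 ?inE //.
by rewrite span_on0 memv0 => /andP[].
Qed.
End Family.

(** * Laurent polynomials and pairings *)

Lemma fsum_mem (k : fieldType) (E : vectType k) (U : {vspace E}) (I : choiceType)
  (A : set I) (n : I -> E) : (forall a, A a -> n a \in U) -> \sum_(a \in A) n a \in U.
Proof.
move=> nU; case: finite_supportP => [_|X XA _ _]; first by rewrite big_nil mem0v.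
by rewrite big_seq; apply: rpred_sum => a /XA/nU.
Qed.

Lemma fsum_eq1 (V : nmodType) (I : choiceType) (A : set I) (a0 : I) (n : I -> V) :
  A a0 -> (forall a, a != a0 -> n a = 0) -> \sum_(a \in A) n a = n a0.
Proof.
move=> Aa0 n0; rewrite -(@fsbig_widen _ _ _ _ [set a0]%classic) ?fsbig_set1 //.
  by move=> _ ->.
by move=> a /= [_ /eqP/n0].
Qed.

Section Pairing.
Variables (K : pzRingType) (m : nat).
Implicit Types (u w : 'rV[K]_m).

Lemma pairingDl u u' w : pairing (u + u') w = pairing u w + pairing u' w.
Proof. by rewrite -big_split; apply: eq_bigr => i _; rewrite mxE mulrDl. Qed.

Lemma pairingNl u w : pairing (- u) w = - pairing u w.
Proof. by rewrite -sumrN; apply: eq_bigr => i _; rewrite mxE mulNr. Qed.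

Lemma pairingBl u u' w : pairing (u - u') w = pairing u w - pairing u' w.
Proof. by rewrite pairingDl pairingNl. Qed.

Lemma pairingNr u w : pairing u (- w) = - pairing u w.
Proof. by rewrite -sumrN; apply: eq_bigr => i _; rewrite mxE mulrN. Qed.

Lemma pairing_delta i w : pairing (delta_mx 0 i) w = w 0 i.
Proof.
rewrite /pairing (bigD1 i) //= mxE !eqxx mul1r big1 ?addr0 // => j ji.
by rewrite mxE eqxx (negPf ji) mul0r.
Qed.
End Pairing.

(** * Limits along one-parameter subgroups *)

Section Laurent.
Variables (k : fieldType) (m : nat).
Local Notation expo := 'rV[int]_m.

Lemma restrict_monomial (E : vectType k) (x a : expo) (g : E) :
  restrict_curve x (monomial a g) = monomial (pairing a x) g.
Proof.
apply/boolp.funext => b; rewrite /restrict_curve /monomial.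
have [->|ba] := eqVneq b (pairing a x).
  by rewrite (@fsum_eq1 _ _ _ a) ?eqxx // => c /negPf->.
by apply: fsbig1 => c /= cb; case: eqP => // ca; rewrite -cb ca eqxx in ba.
Qed.

Lemma finsupp_monomial (E : vectType k) (a : expo) (g : E) : finsupp (monomial a g).
Proof.
apply: (@sub_finite_set _ _ [set a]%classic) (finite_set1 a) => b /=.
by rewrite /monomial; have [//|_] := eqVneq b a; case/eqP.
Qed.

Lemma monomial_oppE (E : vectType k) (a : expo) (g : E) :
  (fun b => monomial a g (- b)) = monomial (- a) g.
Proof. by apply/boolp.funext => b; rewrite /monomial eqr_oppLR. Qed.

Lemma monomial0 (G : zmodType) (E : lmodType k) (a : G) : monomial a (0 : E) = fun=> 0.
Proof. by apply/boolp.funext => b; rewrite /monomial if_same. Qed.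

(** The filtration of the fiber [E] at [x0] by the order of vanishing along the
   one-parameter subgroup [x] is the one by the spans of the [f i] with [d <= y i],
   as soon as the [t^a f i] with [<a, x> = - y i] are sections and the coefficients of
   sections satisfy the bound that this suggests. *)
Lemma limit_exists_span (E : vectType k) (F : sections m E) (f : 'I_m -> E)
    (x y : expo) :
    (forall s i, cone s x ->
       exists2 a, F s (monomial a (f i)) & pairing a x = - y 0 i) ->
    (forall s n a, cone s x -> F s n ->
       n a \in span_on f [set j | - pairing a x <= y 0 j]) ->
  forall d g, limit_exists F x d g <-> g \in span_on f [set j | d <= y 0 j].
Proof.
move=> gens bound d g; split=> [[s xs H]|/span_onP[c ->]].
  suff hP h : submod_gen [set a : int | 0 <= a]%classic
      [set restrict_curve x n | n in F s]%classic h ->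
      forall b, h b \in span_on f [set j | - b <= y 0 j].
    by have := hP _ H (- d); rewrite opprK /monomial eqxx.
  elim=> [b|c e _ {}h /= e0 [n Fn <-] _ IH b]; first exact: mem0v.
  apply: rpredD (IH b); apply/rpredZ/fsum_mem => a /= ab.
  apply: (subvP (span_onS f _)) (bound _ _ a xs Fn); apply/subsetP => j.
  rewrite !inE ab; apply: le_trans; by rewrite lerN2 gerBl.
have [s xs] := cone_exists x; exists s => //; rewrite -big_enum /=.
have : all (mem [set j | d <= y 0 j]) (enum [set j | d <= y 0 j]).
  by apply/allP => i; rewrite mem_enum.
elim: (enum _) => [_|i r IH /= /andP[iA /IH rG]].
  by rewrite big_nil monomial0; apply: submod_gen0.
have [a Fa ax] := gens s i xs.
rewrite big_cons (_ : monomial _ _ = fun b => c i *: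
  shift (y 0 i - d) (restrict_curve x (monomial a (f i))) b +
  monomial (- d) (\sum_(j <- r) c j *: f j) b).
  apply: submod_genS rG; last by exists (monomial a (f i)).
  by rewrite /= subr_ge0; rewrite inE in iA.
apply/boolp.funext => b; rewrite restrict_monomial ax /shift /monomial.
rewrite subr_eq addKr.
by case: eqP => _; rewrite ?scaler0 ?addr0.
Qed.

(** Everything about the valuation of [F] along [x] is read off the filtration, which
   jumps at entries of [y] only. *)
Lemma tropicalization_criterion (R : realType) (E : vectType k) (F : sections m E)
    (f : 'I_m -> E) (M : matroid 'I_m) (Phi : 'rV[R]_m -> 'rV[R]_m) (y : expo -> expo) :
    loop_free M -> is_linear_matroid f M -> <<[seq f i | i <- enum 'I_m]>>%VS = fullv ->
    tropical_bundle M Phi ->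
    (forall x, Phi (int_row R x) = tautological_map R M (int_row R (y x))) ->
    (forall x d g, limit_exists F x d g <-> g \in span_on f [set j | d <= y x 0 j]) ->
  is_tropicalization F f M Phi.
Proof.
move=> lf lin span tb PhiE limE.
have lePhi x (d : int) i : (d%:~R <= Phi (int_row R x) 0 i) =
    (f i \in span_on f [set j | d <= y x 0 j]).
  rewrite PhiE le_tautological // -(mspan_linear _ _ lin).
  by congr (_ \in mspan _ _); apply/setP => j; rewrite !inE mxE ler_int.
split=> // [|x i|x d g].
- by split=> // i; apply: linear_neq0 lin lf.
- have [j [PhiEj _]] := tautological_spec lf (int_row R (y x)) i.
  rewrite -PhiE mxE in PhiEj; exists (y x 0 j) => //; split=> [|d'].
    by apply/limE; rewrite -lePhi PhiEj.
  by move/limE; rewrite -lePhi PhiEj ler_int.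
have -> : <<[seq f i | i <- enum 'I_m & (d%:~R <= Phi (int_row R x) 0 i)%R]>>%VS =
    span_on f [set j | d <= y x 0 j].
  have -> : [seq i <- enum 'I_m | d%:~R <= Phi (int_row R x) 0 i] =
      enum [set i | d%:~R <= Phi (int_row R x) 0 i].
    by rewrite enumT [RHS]/enum_mem; apply: eq_filter => i; rewrite /= inE.
  apply/eqP; rewrite eqEsubv; apply/andP; split.
    by apply: span_on_sub => i; rewrite inE lePhi.
  apply: span_on_sub => i; rewrite inE => di; apply: mem_span_on.
  by rewrite inE lePhi mem_span_on // inE.
split=> [[->|[e [/limE ge _] de]]|gd]; first exact: mem0v.
  by apply: subvP ge; apply: span_onS; apply/subsetP => j; rewrite !inE; apply: le_trans.
have [->|g0] := eqVneq g 0; [by left | right].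
have [||j [gj jmax]] := @top_level _ _ (y x) (fun A => g \in span_on f A) d.
- by rewrite span_on0 memv0.
- by [].
exists (y x 0 j); last exact: jmax.
by split=> [|d' /limE/jmax//]; apply/limE.
Qed.
End Laurent.

(** * Spans of linear functionals *)

(** By induction on [fs]: if [phi] does not vanish at some common zero [v] of the tail,
   neither does the head [f], and subtracting a multiple of [f] from [phi] reduces to
   the tail. *)
Lemma functional_span (k : fieldType) (V : vectType k) (fs : seq 'Hom(V, k^o))
    (phi : 'Hom(V, k^o)) :
  (forall v, (forall f, f \in fs -> f v = 0) -> phi v = 0) -> phi \in <<fs>>%VS.
Proof.
elim: fs phi => [|f fs IH] phi phi0.
  by rewrite span_nil memv0; apply/eqP/lfunP => v; rewrite phi0 ?lfunE.
rewrite span_cons; have [[v [fsv phiv]]|none] :=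
    boolp.pselect (exists v, (forall f', f' \in fs -> f' v = 0) /\ phi v != 0);
    last first.
  apply: (subvP (addvSr _ _)); apply: IH => v fsv; apply/eqP.
  by apply: boolp.contrapT => /negP phiv; apply: none; exists v.
have fv : f v != 0.
  apply: contraNneq phiv => fv; apply/eqP/phi0 => f'.
  by rewrite inE => /predU1P[->//|]; apply: fsv.
pose c : k := phi v / f v.
rewrite -[phi](subrK (c *: f)) addrC; apply: memv_add; first exact/memvZ/memv_line.
apply: IH => u fsu; rewrite add_lfunE opp_lfunE scale_lfunE /c.
have /phi0 : forall f', f' \in f :: fs -> f' (u - (f u / f v : k) *: v) = 0.
  move=> f'; rewrite linearB linearZ /= inE => /predU1P[->|f'fs].
    by rewrite [_ *: _]mulfVK // subrr.
  by rewrite (fsu f') // (fsv f') // scaler0 subrr.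
rewrite linearB linearZ /= => /eqP; rewrite subr_eq0 => /eqP->.
by apply/eqP; rewrite subr_eq0 /GRing.scale /= mulrAC [f u * _]mulrC mulrAC.
Qed.

(** * Characters of the charts *)

Section Charts.
Variables (k : fieldType) (m : nat).
Local Notation expo := 'rV[int]_m.
Local Notation delta i := (delta_mx 0 i : expo).
Local Notation degree u := (pairing u (const_mx 1 : expo)).
Implicit Types (s : 'S_m) (a b c u : expo).

Lemma chart_charD s u u' : chart_char s u -> chart_char s u' -> chart_char s (u + u').
Proof. by move=> uP u'P w ws; rewrite pairingDl addr_ge0 ?uP ?u'P. Qed.

Lemma chart_char0 s : chart_char s 0.
Proof. by move=> w _; rewrite /pairing big1 // => i _; rewrite mxE mul0r. Qed.

Lemma chart_char_degree s u : chart_char s u -> degree u = 0.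
Proof.
move=> uP; apply/eqP; rewrite eq_le uP ?andbT; last by move=> i j _; rewrite !mxE.
by rewrite -oppr_ge0 -pairingNr uP // => i j _; rewrite !mxE.
Qed.

Lemma chart_char_cremona s u : chart_char (cremona_perm s) u <-> chart_char s (- u).
Proof.
have cremonaK : cremona_perm (cremona_perm s) = s.
  by apply/permP => i; rewrite !cremona_permE rev_ordK.
split=> uP w /cone_cremona; first by move=> /uP; rewrite pairingNl pairingNr.
by rewrite cremonaK => /uP; rewrite pairingNl pairingNr opprK.
Qed.

(** The characters of a chart generate the group of characters of degree 0, so finitely
   many of the latter are moved into the chart by one of the former. *)
Lemma chart_char_deep s (us : seq expo) : (forall u, u \in us -> degree u = 0) ->
  exists2 c, chart_char s c & forall u, u \in us -> chart_char s (c + u).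
Proof.
elim: us => [|u us IH] deg; first by exists 0 => //; apply: chart_char0.
have [c' c'P c'us] : exists2 c, chart_char s c &
    forall u, u \in us -> chart_char s (c + u).
  by apply: IH => u' u'us; apply: deg; rewrite inE u'us orbT.
suff [c cP cu] : exists2 c, chart_char s c & chart_char s (c + u).
  exists (c + c') => [|u']; first exact: chart_charD.
  rewrite inE => /predU1P[->|/c'us u'P]; last by rewrite -addrA; apply: chart_charD.
  by rewrite addrAC; apply: chart_charD.
have {deg}/eqP := deg u (mem_head _ _); rewrite /pairing.
under eq_bigr do rewrite mxE mulr1; move=> /eqP deg.
have [m0|m_gt0] := posnP m.
  have triv u' : chart_char s u'.
    move=> w _; rewrite /pairing big1 // => i.
    by move: (ltn_ord i); rewrite [X in (_ < X)%N]m0.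
  by exists 0; apply: triv.
have lm : (m.-1 < m)%N by rewrite prednK.
(* As [l] comes last for [s], the characters [delta i - delta l] belong to the chart.
   Now [u] is the combination of these with the coefficients [u i]; the witness has
   the coefficients [`|u i|]. *)
pose l := s (Ordinal lm).
have lmin w i : cone s w -> 0 <= w 0 i - w 0 l.
  move=> ws; rewrite subr_ge0 -[i](permKV s); apply: ws => /=.
  by rewrite -ltnS prednK.
have sumE (e : 'I_m -> int) (w : expo) :
    pairing (\row_i e i - (\sum_i e i) *: delta l) w = \sum_i e i * (w 0 i - w 0 l).
  rewrite pairingBl; under [RHS]eq_bigr do rewrite mulrBr.
  rewrite sumrB -mulr_suml; congr (_ - _); first by apply: eq_bigr => i _; rewrite mxE.
  rewrite -[X in _ = _ * X]pairing_delta mulr_sumr.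
  by apply: eq_bigr => i _; rewrite !mxE mulrA.
exists (\row_i `|u 0 i| - (\sum_i `|u 0 i|) *: delta l) => w ws.
  by rewrite sumE sumr_ge0 // => i _; rewrite mulr_ge0 // lmin.
have -> : \row_i `|u 0 i| - (\sum_i `|u 0 i|) *: delta l + u =
    \row_i (`|u 0 i| + u 0 i) - (\sum_i (`|u 0 i| + u 0 i)) *: delta l.
  by rewrite big_split /= deg addr0 addrAC; congr (_ - _); apply/rowP => i; rewrite !mxE.
rewrite sumE sumr_ge0 // => i _; rewrite mulr_ge0 ?lmin //.
by rewrite -lerBlDr sub0r; have := ler_norm (- u 0 i); rewrite normrN.
Qed.
End Charts.

(** * The universal subbundle *)

Section UniversalBundles.
Variables (k : fieldType) (m : nat) (L : {vspace 'rV[k]_m}).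
Local Notation expo := 'rV[int]_m.
Local Notation delta i := (delta_mx 0 i : expo).
Local Notation degree u := (pairing u (const_mx 1 : expo)).
Implicit Types (s : 'S_m) (a b c : expo) (v : 'rV[k]_m).

Lemma standard_monomial s a v : (forall i, v 0 i != 0 -> chart_char s (a + delta i)) ->
  standard_bundle k m s (monomial a v).
Proof.
move=> vP; split=> [|i b]; first exact: finsupp_monomial.
by rewrite /monomial; case: (b =P a) => [->|_]; [apply: vP | rewrite mxE eqxx].
Qed.

Lemma standard_degree s n a : standard_bundle k m s n -> n a != 0 -> degree a = -1.
Proof.
move=> [_ nP] /rV0Pn[i /nP/chart_char_degree/eqP].
by rewrite pairingDl pairing_delta mxE addr_eq0 => /eqP.
Qed.

(** [coordinate L i] is the [linfun] of this function, whose linearity makes [lfunE]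
   available. *)
Definition coordinate_fun (i : 'I_m) (v : subvs_of L) : k^o := vsval v 0 i.

Fact coordinate_fun_linear i : linear (coordinate_fun i).
Proof. by move=> c u v; rewrite /coordinate_fun linearP !mxE. Qed.

HB.instance Definition _ i :=
  GRing.isLinear.Build k (subvs_of L) k^o _ (coordinate_fun i) (coordinate_fun_linear i).

Lemma coordinateE i (v : subvs_of L) : coordinate L i v = (vsval v) 0 i.
Proof. exact: (lfunE (coordinate_fun i) v). Qed.

Section Subbundle.
Variables (S : sections m 'rV[k]_m).
Hypotheses (hS : is_equivariant_subbundle (standard_bundle k m) S) (hL : has_fiber S L).

Lemma sub_standard s n : S s n -> standard_bundle k m s n.
Proof. by case: hS => + _ _ _ _; apply. Qed.

Lemma subbundle_lin s (lam : k) d n h : chart_char s d -> S s n -> S s h ->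
  S s (fun b => lam *: shift d n b + h b).
Proof.
case: hS => _ gen _ _ _ dP nS hS'; apply: (gen); apply: submod_genS => //.
have -> : h = fun b => 1 *: shift 0 h b + (fun=> 0) b.
  by apply/boolp.funext => b; rewrite scale1r addr0 /shift subr0.
by apply: submod_genS => //; [apply: chart_char0 | apply: submod_gen0].
Qed.

(** A vector of [L] is a sum of coefficients of sections of [S], hence [t^a v] becomes a
   section of [S] after multiplication by a character [c] that is deep in the cone of
   the chart; as [S] is a direct summand, it was one before. *)
Lemma subbundle_monomial s a v : v \in L -> standard_bundle k m s (monomial a v) ->
  S s (monomial a v).
Proof.
move=> vL nV; have [S_V S_gen /(_ s)[C [C_V C_gen SC0 dec]] _ S_T] := hS.
have S0 : S s (fun=> 0) by apply: S_gen; apply: submod_gen0.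
have [v0|v0] := eqVneq v 0.
  by rewrite v0 monomial0.
have adeg : degree a = -1.
  by apply: (standard_degree nV); rewrite /monomial eqxx.
have [n Sn nv] : exists2 n, S s n & eval1 n = v by apply/(hL s).
have [r rP rE] : exists2 r : seq expo, (forall b, b \in r -> n b != 0) &
    v = \sum_(b <- r) n b.
  rewrite -nv /eval1; case: finite_supportP => [_|X _ _ XE]; first by exists [::].
  exists (finmap.enum_fset X) => // b bX.
  by have [_ /eqP] : ([set: expo] `&` [eta n] @^-1` [set~ 0])%classic b by rewrite -XE.
have [c cP cr] : exists2 c, chart_char s c &
    forall u, u \in [seq a - b | b <- r] -> chart_char s (c + u).
  apply: chart_char_deep => _ /mapP[b /rP nb ->].
  by rewrite pairingBl adeg (standard_degree (S_V _ _ Sn) nb) subrr.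
have Sc : S s (monomial (a + c) v).
  have {}cr b : b \in r -> chart_char s (a + c - b).
    by move=> br; rewrite addrAC addrC; apply: cr; apply: map_f.
  rewrite rE; elim: r {rE rP} cr => [_|b r IH cr].
    by rewrite big_nil monomial0.
  rewrite big_cons (_ : monomial _ _ = fun x =>
    1 *: shift (a + c - b) (monomial b (n b)) x + monomial (a + c) (\sum_(b <- r) n b) x).
    apply: subbundle_lin; [by apply: cr; rewrite inE eqxx | exact: S_T |].
    by apply: IH => b' b'r; apply: cr; rewrite inE b'r orbT.
  apply/boolp.funext => x; rewrite scale1r /shift /monomial subr_eq [b + _]addrC subrK.
  by case: eqP => _; rewrite ?addr0.
have [n1 [n2 [Sn1 Cn2 nE]]] := dec _ nV.
(* [n2] vanishes because [t^c n2] is in both summands. *)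
suff n20 : n2 = fun=> 0.
  by rewrite nE n20; under boolp.eq_fun do rewrite addr0.
have shiftE : shift c n2 = fun b => -1 *: shift c n1 b + monomial (a + c) v b.
  apply/boolp.funext => b; rewrite scaleN1r addrC /shift.
  have -> : monomial (a + c) v b = monomial a v (b - c).
    by rewrite /monomial subr_eq.
  by rewrite nE addrC addKr.
have shift0 : shift c n2 = fun=> 0.
  apply: SC0; first by rewrite shiftE; apply: subbundle_lin.
  apply: C_gen; have -> : shift c n2 = fun b => 1 *: shift c n2 b + (fun=> 0) b.
    by apply/boolp.funext => b; rewrite scale1r addr0.
  by apply: submod_genS => //; apply: submod_gen0.
apply/boolp.funext => b; have := congr1 (fun h => h (b + c)) shift0.
by rewrite /shift addrK.
Qed.

Local Notation F := (dual_bundle (as_bundle L (pull_cremona_bundle S))).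

(** A coefficient [phi a] of a section kills every [v] in [L] that is killed by the
   coordinates which the claim allows: otherwise the value of the section on a
   section [t^(delta j) v] would not be regular at the limit point of [x]. *)
Lemma dual_sub_limit (x : expo) d g : limit_exists F x d g <->
  g \in span_on (coordinate L) [set j | d <= x 0 j].
Proof.
apply: limit_exists_span => [s i xs|s phi a xs [phifin phiP]].
  exists (- delta i); last by rewrite pairingNl pairing_delta.
  split=> [|n nS b].
    apply: (@sub_finite_set _ _ [set - delta i]%classic) (finite_set1 _) => b /=.
    rewrite /monomial; case: (b =P - delta i) => // _ /eqP[].
    by apply/boolp.funext => v; rewrite lfunE.
  rewrite (@fsum_eq1 _ _ _ (- delta i)) // => [|a /negPf ai]; last first.
    by rewrite /monomial ai lfunE.
  rewrite /monomial eqxx opprK coordinateE => ni.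
  have /= [_ /(_ i (- (b + delta i)))] := sub_standard nS.
  by rewrite opprK => /(_ ni); rewrite opprD subrK => /chart_char_cremona; rewrite opprK.
apply: functional_span => v vA; apply/eqP; apply: contraT => phiv.
have v0 : vsval v != 0.
  by apply: contraNneq phiv => v0; rewrite (_ : v = 0) ?linear0 //; apply: val_inj.
have /rV0Pn[i0 vi0] := v0.
(* [j] is the first element of the support of [v], so that [t^(delta j) v] is a
   section of the pull-back of [S]. *)
pose P p := (vsval v) 0 (s p) != 0.
have P0 : P ((s^-1)%g i0) by rewrite /P permKV.
case: (arg_minnP (fun p : 'I_m => val p) P0) => p vp pmin.
set j := s p in vp.
have jP i : (vsval v) 0 i != 0 -> chart_char s (delta j - delta i).
  move=> vi w ws; rewrite pairingBl !pairing_delta subr_ge0.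
  rewrite -[i](permKV s); apply: ws; apply: pmin.
  by rewrite /P permKV.
have nS : as_bundle L (pull_cremona_bundle S) s (monomial (delta j) v).
  rewrite /as_bundle /pull_cremona_bundle /=.
  have -> : (fun b => vsval (monomial (delta j) v (- b))) =
      monomial (- delta j) (vsval v).
    apply/boolp.funext => b; rewrite /monomial eqr_oppLR.
    by case: eqP => // _; rewrite linear0.
  apply: subbundle_monomial; first exact: subvsP.
  apply: standard_monomial => i /jP ji.
  by apply/chart_char_cremona; rewrite opprD opprK.
have := phiP _ nS (a + delta j); rewrite (@fsum_eq1 _ _ _ a) // => [|b ba]; last first.
  rewrite /monomial subr_eq addrC (inj_eq (addrI _)) eq_sym (negPf ba).
  by rewrite linear0.
rewrite addrAC subrr add0r /monomial eqxx => /(_ phiv) /(_ _ xs).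
rewrite pairingDl pairing_delta => jx.
case/eqP: vp; have := vA (coordinate L j); rewrite coordinateE; apply.
by apply: map_f; rewrite mem_enum inE -subr_ge0 opprK addrC.
Qed.
End Subbundle.
End UniversalBundles.

(** * The matroids of a linear subspace *)

Section LinearMatroids.
Variables (k : fieldType) (m : nat) (L : {vspace 'rV[k]_m}).
Variables (Q : vectType k) (q : 'Hom('rV[k]_m, Q)).
Hypotheses (hker : lker q = L) (himg : limg q = fullv).
Local Notation e i := (delta_mx 0 i : 'rV[k]_m).
Local Notation qe := (fun i => q (e i)).
Implicit Types (v : 'rV[k]_m) (I B C : {set 'I_m}) (c : 'I_m -> k).

Lemma map_rowE v : q v = \sum_i v 0 i *: q (e i).
Proof.
by rewrite {1}(row_sum_delta v) linear_sum; apply: eq_bigr => i _; rewrite linearZ.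
Qed.

Lemma mem_kerE v : (v \in L) = (q v == 0).
Proof. by rewrite -hker memv_ker. Qed.

Definition row_on I c : 'rV[k]_m := \row_i (if i \in I then c i else 0).

Lemma map_row_on I c : q (row_on I c) = \sum_(i in I) c i *: q (e i).
Proof.
rewrite map_rowE [RHS]big_mkcond; apply: eq_bigr => i _; rewrite mxE.
by case: ifP => // _; rewrite scale0r.
Qed.

Lemma quotient_full : <<[seq q (e i) | i <- enum 'I_m]>>%VS = fullv.
Proof.
apply/eqP; rewrite eqEsubv subvf /= -himg; apply/subvP => _ /memv_imgP[v _ ->].
rewrite map_rowE; apply: rpred_sum => i _; apply/rpredZ/memv_span.
by apply: (map_f qe); rewrite mem_enum.
Qed.

Lemma coordinate_full :
  <<[seq coordinate L i | i <- enum 'I_m]>>%VS = fullv.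
Proof.
apply/eqP; rewrite eqEsubv subvf /=; apply/subvP => phi _; apply: functional_span => v v0.
rewrite (_ : v = 0) ?linear0 //; apply/val_inj/rowP => i.
by rewrite mxE -coordinateE v0 // map_f // mem_enum.
Qed.

Section Matroid.
Variables (N : matroid 'I_m).
Hypothesis (hN : forall C, circuit N C <-> is_minimal_support L C).

Lemma minimal_support_exists v : v \in L -> v != 0 ->
  exists2 C, is_minimal_support L C & C \subset supp v.
Proof.
move=> vL v0.
pose P C := `[< exists u, [/\ u \in L, u != 0 & supp u = C] >] && (C \subset supp v).
have P0 : P (supp v) by rewrite /P subxx andbT; apply/boolp.asboolP; exists v.
case: (arg_minnP (fun C : {set 'I_m} => #|C|) P0) => C /andP[/boolp.asboolP uC Cv] Cmin.
exists C => //; split=> // u uL u0 uCs; apply/eqP; rewrite eqEcard uCs /=.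
by apply: Cmin; rewrite /P (subset_trans uCs) // andbT; apply/boolp.asboolP; exists u.
Qed.

Lemma quotient_indepP I :
  indep N I <-> forall v, v \in L -> supp v \subset I -> v = 0.
Proof.
split=> [Ii v vL vI|LI].
  apply/eqP; apply: contraT => /(minimal_support_exists vL)[C /hN Cc Cv].
  by move: Cc; rewrite /circuit (indepS (subset_trans Cv vI) Ii).
apply: contraT => /dep_circuit[C /hN[[v [vL v0 vC]] _] CI].
by rewrite (LI v) ?eqxx // in v0; rewrite vC.
Qed.

Lemma quotient_linear : is_linear_matroid qe N.
Proof.
move=> I; apply/idP/free_onP => [/quotient_indepP LI c c0 i iI|fr].
  have /rowP/(_ i) : row_on I c = 0; last by rewrite !mxE iI.
  apply: LI; first by rewrite mem_kerE map_row_on c0.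
  by apply/subsetP => j; rewrite inE mxE; case: ifP => //; rewrite eqxx.
apply/quotient_indepP => v vL vI.
have vE : v = row_on I (v 0).
  apply/rowP => i; rewrite mxE; case: ifPn => // iI; apply/eqP.
  by apply: contraNT iI => vi; apply: (subsetP vI); rewrite inE.
have v0 : forall i, i \in I -> v 0 i = 0.
  by apply: fr; rewrite -map_row_on -vE; apply/eqP; rewrite -mem_kerE.
by apply/rowP => i; rewrite vE !mxE; case: ifP => // /v0.
Qed.

(** A set is independent in the dual exactly if its complement spans the
   quotient by [L]. If a basis [B] of the quotient avoids [I], then for [i] in [I] the vector [e i] is
   congruent modulo [L] to a combination of the [e j] with [j] in [B], and their
   difference is a vector of [L] on which [coordinate i] is the only nonzero one among
   the coordinates in [I]. Conversely such vectors express the [q (e i)] by the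
   [q (e j)] with [j] outside [I]. *)
Lemma coordinate_linear : is_linear_matroid (coordinate L) (mdual N).
Proof.
move=> I; apply/mdual_indepP/free_onP => [[B Bb dis] c c0 i iI|/free_onP fr].
  have : q (e i) \in span_on qe B.
    by rewrite -(mspan_linear _ _ quotient_linear); apply: mspan_basis.
  move=> /span_onP[a qi]; pose v := e i - row_on B a.
  have vL : v \in L by rewrite mem_kerE linearB /= map_row_on qi subrr.
  have vI j : j \in I -> v 0 j = (j == i)%:R.
    by move=> jI; rewrite !mxE eqxx (disjointFl dis jI) subr0.
  have := congr1 (fun f : 'Hom(subvs_of L, k^o) => f (Subvs vL)) c0.
  rewrite sum_lfunE lfunE (bigD1 i) //= big1 ?addr0 => [|j /andP[jI ji]].
    by rewrite scale_lfunE coordinateE /= vI // eqxx /GRing.scale /= mulr1.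
  by rewrite scale_lfunE coordinateE /= vI // (negPf ji) scaler0.
have spanC i : q (e i) \in span_on qe (~: I).
  have [iI|iI] := boolP (i \in I); last first.
    by apply: (mem_span_on qe); rewrite inE.
  have : coordinate L i \notin span_on (coordinate L) (I :\ i).
    move: fr; rewrite -{1}(setD1K iI) free_on_setU1 ?inE ?eqxx //.
    by case/andP.
  move=> /negP iNspan.
  have [v [vI vi]] : exists v : subvs_of L, (forall j, j \in I :\ i ->
      coordinate L j v = 0) /\ coordinate L i v != 0.
    apply: boolp.contrapT => none; apply: iNspan; apply: functional_span => v v0.
    apply/eqP; apply: boolp.contrapT => /negP vi; apply: none; exists v.
    by split=> // j jI; apply/v0/map_f; rewrite mem_enum.
  have /eqP : q (vsval v) = 0 by apply/eqP; rewrite -mem_kerE subvsP.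
  rewrite map_rowE (bigD1 i) //= addr_eq0 => /eqP E.
  rewrite coordinateE in vi.
  rewrite -[q (e i)](scalerK vi) E; apply/rpredZ; rewrite rpredN.
  apply: rpred_sum => j ji; have [jI|jI] := boolP (j \in I).
    by rewrite -coordinateE vI ?inE ?ji // scale0r mem0v.
  by apply/rpredZ/(mem_span_on qe); rewrite inE.
have [J JI] := basis_of_exists N (~: I); exists J; last first.
  by case: JI => JI _ _; rewrite -[I]setCK -subsets_disjoint.
have [_ Ji _] := JI.
apply: indep_spanning_basis => // i.
rewrite mem_mspan_indep // -(mspanE _ JI).
by rewrite (mspan_linear _ _ quotient_linear).
Qed.
End Matroid.

End LinearMatroids.

(** * The universal quotient bundle *)

(** A section of the pull-back is the image under [q] of one of the standard bundle,
   whose [j]-th component at the exponent [a] vanishes unless [<a, x>] is at least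
   [x j]. *)
Lemma quotient_limit (k : fieldType) m (Q : vectType k) (q : 'Hom('rV[k]_m, Q))
    (S : sections m 'rV[k]_m) (W : sections m Q)
    (hW : exact_sequence S (standard_bundle k m) q W) (x : 'rV[int]_m) d g :
  limit_exists (pull_cremona_bundle W) x d g <->
  g \in span_on (fun i => q (delta_mx 0 i)) [set j | d <= (- x) 0 j].
Proof.
apply: limit_exists_span => [s i xs|s n a xs Wn].
  exists (delta_mx 0 i); last by rewrite pairing_delta mxE opprK.
  rewrite /pull_cremona_bundle /= monomial_oppE.
  have [+ _ _] := hW (cremona_perm s).
  move=> /(_ (monomial (- delta_mx 0 i) (delta_mx 0 i))).
  have -> : (fun a : 'rV[int]_m => q (monomial (- delta_mx 0 i) (delta_mx 0 i) a)) =
      monomial (- delta_mx 0 i : 'rV[int]_m) (q (delta_mx 0 i)).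
    by apply/boolp.funext => a; rewrite /monomial; case: (a =P _) => _; rewrite ?linear0.
  apply; apply: standard_monomial => j; rewrite mxE eqxx /=.
  case: (j =P i) => [-> _|]; last by rewrite eqxx.
  by rewrite addNr; apply: chart_char0.
have [_ /(_ _ Wn)[n' [_ n'P] nE] _] := hW (cremona_perm s).
have {nE} -> : n a = q (n' (- a)).
  by have := congr1 (fun h => h (- a)) nE; rewrite opprK.
rewrite map_rowE; apply: rpred_sum => j _; have [->|nj] := eqVneq (n' (- a) 0 j) 0.
  by rewrite scale0r mem0v.
apply/rpredZ/(mem_span_on (fun i => q (delta_mx 0 i))); rewrite inE mxE lerN2.
have := n'P _ _ nj _ (cone_cremona xs).
by rewrite pairingDl pairingNl pairingNr opprK pairing_delta mxE subr_ge0.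
Qed.

(** * Tautological bundles and their Chern classes *)

Theorem theorem1p6 (R : realType) (m : nat) :
  (forall M : matroid 'I_m, loop_free M ->
     tropical_bundle M (tautological_map R M)) /\
  (forall (k : fieldType) (L : {vspace 'rV[k]_m})
     (* [S] and [W] are the universal sub- and quotient bundle before the
        Cremona twist; [q] presents the quotient space k^m / L *)
     (S : sections m 'rV[k]_m)
     (hS : is_equivariant_subbundle (standard_bundle k m) S)
     (hL : has_fiber S L)
     (Q : vectType k) (q : 'Hom('rV[k]_m, Q)) (hker : lker q = L)
     (himg : limg q = fullv)
     (W : sections m Q)
     (hW : exact_sequence S (standard_bundle k m) q W)
     (* [N] is the matroid M^dual(L), and [mdual N] is M(L) *)
     (N : matroid 'I_m)
     (hN : forall C, circuit N C <-> is_minimal_support L C),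
     (loop_free (mdual N) ->
        is_tropicalization
          (dual_bundle (as_bundle L (pull_cremona_bundle S)))
          (coordinate L) (mdual N) (tautological_map R (mdual N))) /\
     (loop_free N ->
        is_tropicalization
          (pull_cremona_bundle W)
          (fun i => q (delta_mx 0 i)) N
          (pull_cremona (tautological_map R N)))) /\
  (forall (M : matroid 'I_m) (i : nat),
     (loop_free M ->
        is_chern_dual_sub M i (tropical_chern M (tautological_map R M) i)) /\
     (loop_free (mdual M) ->
        is_chern_quotient M i
          (tropical_chern (mdual M)
             (pull_cremona (tautological_map R (mdual M))) i))).
Proof.
split; first exact: tautological_tropical_bundle.
split=> [k L S hS hL Q q hker himg W hW N hN|M i]; split=> lf.
- apply: (@tropicalization_criterion _ _ _ _ _ _ _ _ id) => //.
  + exact: (coordinate_linear hker hN).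
  + exact: coordinate_full.
  + exact: tautological_tropical_bundle.
  + exact: (dual_sub_limit hS hL).
- apply: (@tropicalization_criterion _ _ _ _ _ _ _ _ (fun x => - x)) => //.
  + exact: (quotient_linear hker hN).
  + exact: (quotient_full himg).
  + exact: cremona_tropical_bundle.
  + by move=> x; rewrite /pull_cremona /int_row map_mxN.
  + exact: (quotient_limit hW).
- by move=> s w ws; apply: chern_greedy => //; apply: lex_basis_greedy.
- move=> s w ws; rewrite -(chern_greedy lf i (greedy_dual (lex_basis_greedy M ws))).
  by [].
Qed.
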